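(* Let $k>2$ be odd and let $P(\lambda)=\sum_{i=0}^{k}A_i\lambda^i$, $A_i\in\mathbb{C}^{n\times n}$, be a regular matrix polynomial of degree $k$ with $A_0\neq 0$. Assume that $\delta$ is a simple, finite, nonzero eigenvalue of $P(\lambda)$. Let $$\rho_{1}:=\frac{\max_{i=0,\ldots,k}\{1,\|A_{i}\|_{2}^3\}}{\min\{\|A_{k}\|_{2},\|A_{0}\|_{2}\}},\qquad \rho_{2}:=\frac{\min\{\max\{1,\|A_{k}\|_{2}\},\max\{1,\|A_{0}\|_{2}\}\}}{\max_{i=0,\ldots,k}\{\|A_{i}\|_{2}\}}.$$ Then $$\rho_2\le \frac{\kappa_{\mathcal{T}_P}(\delta)}{\kappa_{P}(\delta)}\le 2k^3\rho_1.$$ Moreover, if $|\delta|\neq 1$ and $\min\{|\delta|,\frac{1}{|\delta|}\}\le\frac{1}{k-1}$, then $$\frac{\kappa_{\mathcal{T}_P}(\delta)}{\kappa_{P}(\delta)}\le 4(k+1)\rho_1.$$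
   Context: $\|\cdot\|_2$ is the Euclidean norm of vectors and the spectral norm of matrices. $P(\lambda)=\sum_{i=0}^k A_i\lambda^i$ has degree $k$ if $A_k\ne0$, and is regular if $\det P(\lambda)$ is not identically zero. For regular $P$, a nonzero $x$ with $P(\delta)x=0$ (resp. nonzero $y$ with $y^*P(\delta)=0$) is a right (resp. left) eigenvector associated with the eigenvalue $\delta\in\mathbb{C}$. Condition number. For a regular matrix polynomial $Q(\lambda)=\sum_{i=0}^{d}B_i\lambda^i$ of degree $d$ (in particular for a pencil $Q(\lambda)=\lambda L_1-L_0$) and a simple, finite, nonzero eigenvalue $\delta$ with right eigenvector $x$, the relative normwise condition number with natural weights is $$\kappa_Q(\delta)=\lim_{\epsilon\to0}\sup\Big\{\tfrac{|\Delta\delta|}{\epsilon|\delta|}:[Q(\delta+\Delta\delta)+\Delta Q(\delta+\Delta\delta)](x+\Delta x)=0,\ \|\Delta B_i\|_2\le\epsilon\|B_i\|_2,\ i=0,\ldots,d\Big\},$$ where $\Delta Q(\lambda)=\sum_i\lambda^i\Delta B_i$. It is known that, for any right and left eigenvectors $x,y$ associated with $\delta$, $$\kappa_Q(\delta)=\frac{\left(\sum_{i=0}^{d}|\delta|^i\|B_i\|_2\right)\|y\|_2\|x\|_2}{|\delta|\,|y^*Q'(\delta)x|}.$$ The pencil $\mathcal{T}_P(\lambda)$. For $k$ odd, $\mathcal{T}_P(\lambda)$ is the $nk\times nk$ block-tridiagonal pencil, viewed as a $k\times k$ block matrix with $n\times n$ blocks, whose block $(2i+1,2i+1)$ is $\lambda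 A_{k-2i}+A_{k-2i-1}$ for $i=0,\ldots,\frac{k-1}{2}$; whose blocks $(2i,2i)$ are $0$, whose blocks $(2i-1,2i)$ and $(2i,2i-1)$ are $-I_n$, and whose blocks $(2i,2i+1)$ and $(2i+1,2i)$ are $\lambda I_n$, for $i=1,\ldots,\frac{k-1}{2}$; all other blocks are $0$. It is known that $\mathcal{T}_P(\lambda)$ is a strong linearization of $P(\lambda)$, so $\delta$ is also a simple eigenvalue of $\mathcal{T}_P(\lambda)$. *)

(* Defs.v *)
From HB Require Import structures.
From mathcomp Require Export all_boot all_order all_algebra.
From mathcomp Require Export all_classical all_reals all_analysis.
From mathcomp Require Export complex.
Export Order.TTheory GRing.Theory Num.Theory.
Export numFieldNormedType.Exports.

Set Implicit Arguments.
Unset Strict Implicit.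
Unset Printing Implicit Defensive.

Local Open Scope classical_set_scope.
Local Open Scope ring_scope.

(* The modulus as an element of R; `|z| is its image in R[i]. *)
Definition cabs (R : realType) (z : R[i]) : R := complex.Re `|z|.

Definition norm2 (R : realType) (n : nat) (x : 'cV[R[i]]_n) : R :=
  Num.sqrt (\sum_(i < n) cabs (x i 0) ^+ 2).

(* The operator norm induced by norm2. *)
Definition specnorm (R : realType) (n : nat) (B : 'M[R[i]]_n) : R :=
  sup [set norm2 (B *m x) | x in [set x : 'cV[R[i]]_n | norm2 x <= 1]].

(* \sum_i B_i lambda^i is represented by its coefficients B_0, ..., B_d. *)
Definition matpoly (R : realType) (d n : nat) : Type := 'I_d.+1 -> 'M[R[i]]_n.

Definition mpeval (R : realType) (d n : nat) (Q : matpoly R d n) (z : R[i])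
    : 'M[R[i]]_n :=
  \sum_(i < d.+1) z ^+ i *: Q i.

Definition mpdet (R : realType) (d n : nat) (Q : matpoly R d n)
    : {poly R[i]} :=
  \det (\sum_(i < d.+1) 'X^i *: map_mx polyC (Q i)).

Definition mpregular (R : realType) (d n : nat) (Q : matpoly R d n) : Prop :=
  mpdet Q != 0.

Definition simple_eigenvalue (R : realType) (d n : nat) (Q : matpoly R d n)
    (delta : R[i]) : Prop :=
  mup delta (mpdet Q) = 1%N.

Definition right_eigenvector (R : realType) (d n : nat) (Q : matpoly R d n)
    (delta : R[i]) (x : 'cV[R[i]]_n) : Prop :=
  x != 0 /\ mpeval Q delta *m x = 0.

(* The supremum runs over perturbed eigenpairs that lie within r of the pair
   (delta, x).  Without such a bound, eigenvalues of Q other than delta (or the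
   choice dx = - x) would make it of order 1 / eps, hence the limit infinite. *)
Definition perturbation_ratios (R : realType) (d n : nat) (Q : matpoly R d n)
    (delta : R[i]) (x : 'cV[R[i]]_n) (r eps : R) : set R :=
  [set t | exists (dQ : matpoly R d n) (ddelta : R[i]) (dx : 'cV[R[i]]_n),
    [/\ forall i, specnorm (dQ i) <= eps * specnorm (Q i),
        cabs ddelta <= r,
        norm2 dx <= r,
        (mpeval Q (delta + ddelta) + mpeval dQ (delta + ddelta)) *m (x + dx)
          = 0
      & t = cabs ddelta / (eps * cabs delta)]].

(* For a simple eigenvalue the inner limit does not depend on r once r is small
   enough; the outer limit selects this common value.  The limits are taken in
   \bar R, where lim is 0 when the limit does not exist. *)
Definition condnum (R : realType) (d n : nat) (Q : matpoly R d n)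
    (delta : R[i]) (x : 'cV[R[i]]_n) : \bar R :=
  lim ((fun r : R =>
    lim ((fun eps : R =>
      ereal_sup [set t%:E | t in perturbation_ratios Q delta x r eps])
        @ 0^'+)) @ 0^'+).

(* lambda L1 + L0 *)
Definition linear_coefs (R : realType) (n : nat) (L1 L0 : 'M[R[i]]_n)
    : matpoly R 1 n :=
  fun j => if j == 0 then L0 else L1.

(* Block (p, q) of the pencil T_P, with 1 <= p, q <= k; for p = 2i + 1 the
   indices k - 2i and k - 2i - 1 are k.+1 - p and k - p. *)
Definition TP_block (R : realType) (k n : nat) (A : matpoly R k n) (p q : nat)
    : matpoly R 1 n :=
  if p == q then
    if odd p then linear_coefs (A (inord (k.+1 - p))) (A (inord (k - p)))
    else linear_coefs 0 0
  else if (q == p.+1) || (p == q.+1) then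
    if odd (minn p q) then linear_coefs 0 (- 1%:M) else linear_coefs 1%:M 0
  else linear_coefs 0 0.

Definition TP (R : realType) (k n : nat) (A : matpoly R k n)
    : matpoly R 1 (\sum_(a < k) n) :=
  fun j => \mxblock_(a < k, b < k) TP_block A a.+1 b.+1 j.

Definition rho1 (R : realType) (k n : nat) (A : matpoly R k n) : R :=
  \big[Num.max/1]_(i < k.+1) (specnorm (A i) ^+ 3)
    / Num.min (specnorm (A ord_max)) (specnorm (A ord0)).

(* Starting the maximum at 0 is harmless, since norms are nonnegative. *)
Definition rho2 (R : realType) (k n : nat) (A : matpoly R k n) : R :=
  Num.min (Num.max 1 (specnorm (A ord_max))) (Num.max 1 (specnorm (A ord0)))
    / \big[Num.max/0]_(i < k.+1) specnorm (A i).

(* Main.v *)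
(* Let [delta] be a simple eigenvalue with right and left eigenvectors [x], [y].
   If [(delta + t, u)] is an eigenpair of a perturbation of relative size [eps]
   near [(delta, x)], multiplying the eigenvector equation by [y^*] gives
   [|t| <= eps * kappa * |delta| + o(eps)]; conversely an explicit rank-one
   perturbation makes any [t] below this bound an actual perturbation.  This is
   the classical formula for the condition number, in which the numbers
   [y^* Q'(delta) x] of [A] and of [TP A] turn out to be equal, so the ratio of
   the condition numbers is
     [(||L0|| + |delta| ||L1||) ||w|| ||z|| /
      (\sum_i |delta|^i ||A_i|| * ||v|| ||u||)],
   where [v] and [u] are the last blocks of the left and right eigenvectors [w]
   and [z] of the pencil.  The odd-numbered blocks of [z] are powers of [delta]
   times [u], and the others solve a two-term recurrence, which is used forwards
   or backwards according to whether [|delta| <= 1] or not. *)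

Require Import Defs.
From mathcomp Require Import ring lra zify.

Local Open Scope classical_set_scope.
Local Open Scope ring_scope.

Set Implicit Arguments.
Unset Strict Implicit.
Unset Printing Implicit Defensive.

(** * Euclidean and spectral norms *)

Section Norms.
Variable R : realType.
Implicit Types (a b : R[i]) (n : nat).

(** Both condition numbers are computed from [simple_null]. For [A] it follows from the multiplicity
    of [delta]; for [TP A] it is obtained by passing to the last block, which is injective on null
    vectors of the pencil and sends them to null vectors of [A]. Left eigenvectors are rows [y] with
    [y *m mpeval Q a = 0], without conjugation. The block pattern of the pencil is symmetric, so
    their transposes are right null vectors of the pencil of the transposed coefficients, and every
    estimate for [z] also serves for [w]. With k = 2m + 1, the upper bounds are two instances of one
    estimate with constant 4 (m + 1 + m q^2), where q controls the growth of the blocks given by the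
    recurrence: q = 2m is always admissible, and q = 1 when min(|delta|, 1/|delta|) <= 1/(k - 1). *)

Lemma cabsE a : cabs a = Normc.normc a.
Proof. by []. Qed.

Lemma cabs_ge0 a : 0 <= cabs a.
Proof. by rewrite cabsE; case: a => *; apply: sqrtr_ge0. Qed.

Lemma cabs0 : cabs (0 : R[i]) = 0.
Proof. by rewrite cabsE Normc.normc0. Qed.

Lemma cabs1 : cabs (1 : R[i]) = 1.
Proof. by rewrite cabsE Normc.normc1. Qed.

Lemma cabs_eq0 a : (cabs a == 0) = (a == 0).
Proof.
by apply/eqP/eqP => [|->]; [apply: Normc.eq0_normc | apply: cabs0].
Qed.

Lemma cabs_gt0 a : (0 < cabs a) = (a != 0).
Proof. by rewrite lt0r cabs_ge0 andbT cabs_eq0. Qed.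

Lemma cabsM a b : cabs (a * b) = cabs a * cabs b.
Proof. by rewrite !cabsE Normc.normcM. Qed.

Lemma cabsN a : cabs (- a) = cabs a.
Proof. by rewrite !cabsE normcN. Qed.

Lemma cabsV a : cabs a^-1 = (cabs a)^-1.
Proof. by rewrite !cabsE Normc.normcV. Qed.

Lemma cabsX a i : cabs (a ^+ i) = cabs a ^+ i.
Proof. by elim: i => [|i IHi]; rewrite ?cabs1 // !exprS cabsM IHi. Qed.

Lemma ler_cabsD a b : cabs (a + b) <= cabs a + cabs b.
Proof. by rewrite !cabsE; apply: le_normcD. Qed.

Lemma lerB_cabsD a b : cabs a - cabs b <= cabs (a + b).
Proof. by rewrite lerBlDr -{1}(addrK b a) -(cabsN b) ler_cabsD. Qed.

Lemma ler_cabs_sum (I : finType) (F : I -> R[i]) :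
  cabs (\sum_i F i) <= \sum_i cabs (F i).
Proof.
elim/big_rec2: _ => [|i y x _ le_xy]; first by rewrite cabs0.
by apply: (le_trans (ler_cabsD _ _)); rewrite lerD2l.
Qed.

Lemma cabs_real (c : R) : cabs (real_complex R c) = `|c|.
Proof. by rewrite cabsE /= expr0n /= addr0 sqrtr_sqr. Qed.

Lemma cabsJ a : cabs (conjc a) = cabs a.
Proof. by rewrite /cabs normcJ. Qed.

Lemma mulcJ a : a * conjc a = real_complex R (cabs a ^+ 2).
Proof. by rewrite -sqr_normc (rmorphXn (real_complex R)). Qed.

(** Cauchy-Schwarz by Lagrange's identity: twice the difference of the squares is the double sum of
    the squares of [f i * g j - f j * g i]. *)
Lemma sum_mul_le (I : finType) (f g : I -> R) :
    (forall i, 0 <= f i) -> (forall i, 0 <= g i) ->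
  \sum_i f i * g i
    <= Num.sqrt (\sum_i f i ^+ 2) * Num.sqrt (\sum_i g i ^+ 2).
Proof.
move=> f_ge0 g_ge0; set F := \sum_i f i ^+ 2; set G := \sum_i g i ^+ 2.
have F_ge0 : 0 <= F by apply: sumr_ge0 => i _; apply: sqr_ge0.
have G_ge0 : 0 <= G by apply: sumr_ge0 => i _; apply: sqr_ge0.
have H_ge0 : 0 <= \sum_i f i * g i by apply: sumr_ge0 => i _; apply: mulr_ge0.
rewrite -sqrtrM // -(ler_pXn2r (_ : 0 < 2)%N) ?nnegrE ?sqrtr_ge0 //.
rewrite sqr_sqrtr ?mulr_ge0 //.
suff : 0 <= 2 * (F * G - (\sum_i f i * g i) ^+ 2).
  by rewrite pmulr_rge0 ?subr_ge0.
have -> : 2 * (F * G - (\sum_i f i * g i) ^+ 2)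
    = \sum_i \sum_j (f i * g j - f j * g i) ^+ 2.
  have -> : \sum_i \sum_j (f i * g j - f j * g i) ^+ 2 =
      \sum_i (f i ^+ 2 * G + g i ^+ 2 * F - 2 * (f i * g i) * \sum_j f j * g j).
    apply: eq_bigr => i _; rewrite !mulr_sumr -sumrN -!big_split /=.
    by apply: eq_bigr => j _; ring.
  rewrite !big_split /= sumrN -!mulr_suml -mulr_sumr -/F -/G; ring.
by do 2!apply: sumr_ge0 => ? _; apply: sqr_ge0.
Qed.

Lemma norm2_ge0 n (x : 'cV[R[i]]_n) : 0 <= norm2 x.
Proof. exact: sqrtr_ge0. Qed.

Lemma sqr_norm2 n (x : 'cV[R[i]]_n) : norm2 x ^+ 2 = \sum_i cabs (x i 0) ^+ 2.
Proof. by rewrite sqr_sqrtr // sumr_ge0 // => i _; apply: sqr_ge0. Qed.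

Lemma norm2_eq0 n (x : 'cV[R[i]]_n) : (norm2 x == 0) = (x == 0).
Proof.
apply/eqP/eqP => [x0|->]; last first.
  by rewrite /norm2 big1 ?sqrtr0 // => i _; rewrite mxE cabs0 expr0n.
apply/colP => i; rewrite mxE; apply/eqP.
have := sqr_norm2 x; rewrite x0 expr0n /= => /esym/eqP.
rewrite psumr_eq0 => [/allP/(_ i)|j _]; last exact: sqr_ge0.
by rewrite mem_index_enum sqrf_eq0 cabs_eq0 => /(_ isT).
Qed.

Lemma norm20 n : norm2 (0 : 'cV[R[i]]_n) = 0.
Proof. by apply/eqP; rewrite norm2_eq0. Qed.

Lemma norm2_gt0 n (x : 'cV[R[i]]_n) : (0 < norm2 x) = (x != 0).
Proof. by rewrite lt0r norm2_ge0 andbT norm2_eq0. Qed.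

Lemma norm2Z n a (x : 'cV[R[i]]_n) : norm2 (a *: x) = cabs a * norm2 x.
Proof.
apply/eqP; rewrite -(eqrXn2 (_ : 0 < 2)%N) ?mulr_ge0 ?cabs_ge0 ?norm2_ge0 //.
rewrite exprMn !sqr_norm2 mulr_sumr; apply/eqP.
by apply: eq_bigr => i _; rewrite mxE cabsM exprMn.
Qed.

Lemma norm2N n (x : 'cV[R[i]]_n) : norm2 (- x) = norm2 x.
Proof. by rewrite -scaleN1r norm2Z cabsN cabs1 mul1r. Qed.

Lemma ler_norm2D n (x y : 'cV[R[i]]_n) : norm2 (x + y) <= norm2 x + norm2 y.
Proof.
rewrite -(ler_pXn2r (_ : 0 < 2)%N) ?nnegrE ?addr_ge0 ?norm2_ge0 //.
rewrite sqrrD !sqr_norm2.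
apply: (@le_trans _ _ (\sum_i (cabs (x i 0) ^+ 2
    + (cabs (x i 0) * cabs (y i 0)) *+ 2 + cabs (y i 0) ^+ 2))).
  apply: ler_sum => i _; rewrite mxE -sqrrD.
  by rewrite ler_pXn2r ?nnegrE ?addr_ge0 ?cabs_ge0 ?ler_cabsD.
rewrite !big_split /= lerD2r lerD2l -mulr2n lerMn2r /=.
by apply: sum_mul_le => i; apply: cabs_ge0.
Qed.

Lemma ler_norm2B n (x y : 'cV[R[i]]_n) : norm2 x - norm2 y <= norm2 (x + y).
Proof. by rewrite lerBlDr -{1}(addrK y x) -(norm2N y) ler_norm2D. Qed.

Lemma ler_norm2_sum n (I : finType) (F : I -> 'cV[R[i]]_n) :
  norm2 (\sum_i F i) <= \sum_i norm2 (F i).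
Proof.
elim/big_rec2: _ => [|i y x _ le_xy]; first by rewrite norm20.
by apply: (le_trans (ler_norm2D _ _)); rewrite lerD2l.
Qed.

Lemma cabs_mulmx n (y : 'rV[R[i]]_n) (x : 'cV[R[i]]_n) :
  cabs ((y *m x) 0 0) <= norm2 y^T * norm2 x.
Proof.
rewrite mxE; apply: (le_trans (ler_cabs_sum _)).
rewrite (eq_bigr (fun i => cabs (y^T i 0) * cabs (x i 0))) => [|i _].
  by apply: sum_mul_le => i; apply: cabs_ge0.
by rewrite cabsM mxE.
Qed.

Lemma mulmx_tr_conj n (x : 'cV[R[i]]_n) :
  (x^T *m map_mx (@conjc R) x) 0 0 = real_complex R (norm2 x ^+ 2).
Proof.
rewrite mxE sqr_norm2 rmorph_sum; apply: eq_bigr => i _.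
by rewrite !mxE mulcJ.
Qed.

Lemma norm2_conj n (x : 'cV[R[i]]_n) : norm2 (map_mx (@conjc R) x) = norm2 x.
Proof.
by congr Num.sqrt; apply: eq_bigr => i _; rewrite mxE cabsJ.
Qed.

Section SpectralNorm.
Variable n : nat.
Implicit Types (B : 'M[R[i]]_n) (x : 'cV[R[i]]_n).

(** A crude bound by the column norms, which makes the supremum in [specnorm] that of a bounded
    set. *)
Lemma norm2_mulmx_bounded B :
  exists2 C, 0 <= C & forall x, norm2 (B *m x) <= C * norm2 x.
Proof.
exists (\sum_j norm2 (col j B)) => [|x].
  by apply: sumr_ge0 => j _; apply: norm2_ge0.
have -> : B *m x = \sum_j x j 0 *: col j B.
  apply/colP => i; rewrite mxE summxE; apply: eq_bigr => j _.
  by rewrite !mxE mulrC.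
apply: (le_trans (ler_norm2_sum _)); rewrite mulr_suml.
apply: ler_sum => j _; rewrite norm2Z mulrC ler_wpM2l ?norm2_ge0 //.
rewrite -(ler_pXn2r (_ : 0 < 2)%N) ?nnegrE ?norm2_ge0 ?cabs_ge0 //.
rewrite sqr_norm2 (bigD1 j) //= lerDl.
by apply: sumr_ge0 => i _; apply: sqr_ge0.
Qed.

Lemma specnorm_has_sup B :
  has_sup [set norm2 (B *m x) | x in [set x | norm2 x <= 1]].
Proof.
split; first by exists (norm2 (B *m 0)), 0 => //=; rewrite norm20.
have [C C_ge0 leC] := norm2_mulmx_bounded B.
exists C => _ [x /= x_le1 <-]; apply: (le_trans (leC x)).
by rewrite -[leRHS]mulr1 ler_wpM2l.
Qed.

Lemma specnorm_ge0 B : 0 <= specnorm B.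
Proof.
apply: (le_trans (norm2_ge0 (B *m 0))).
apply: (sup_upper_bound (specnorm_has_sup B)).
by exists 0 => //=; rewrite norm20.
Qed.

Lemma norm2_mulmx B x : norm2 (B *m x) <= specnorm B * norm2 x.
Proof.
have [->|x_neq0] := eqVneq x 0; first by rewrite mulmx0 norm20 mulr0.
have Nx_gt0 : 0 < norm2 x by rewrite norm2_gt0.
rewrite -ler_pdivrMr //; apply: (sup_upper_bound (specnorm_has_sup B)).
exists (real_complex R (norm2 x)^-1 *: x).
  by rewrite /= norm2Z cabs_real ger0_norm ?invr_ge0 ?norm2_ge0 ?mulVf ?gt_eqF.
by rewrite -scalemxAr norm2Z cabs_real ger0_norm ?invr_ge0 ?norm2_ge0 // mulrC.
Qed.

Lemma specnorm_le B (c : R) : 0 <= c ->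
  (forall x, norm2 (B *m x) <= c * norm2 x) -> specnorm B <= c.
Proof.
move=> c_ge0 leBc; have [neB _] := specnorm_has_sup B.
apply: ge_sup neB _ => _ [x /= x_le1 <-]; apply: (le_trans (leBc x)).
by rewrite -[leRHS]mulr1 ler_wpM2l.
Qed.

Lemma specnorm_ge B x (c : R) : x != 0 ->
  c * norm2 x <= norm2 (B *m x) -> c <= specnorm B.
Proof.
move=> x_neq0 le_cB; rewrite -(ler_pM2r (_ : 0 < norm2 x)) ?norm2_gt0 //.
exact: (le_trans le_cB (norm2_mulmx B x)).
Qed.

Lemma specnorm_gt0 B : (0 < specnorm B) = (B != 0).
Proof.
apply/idP/idP => [|B_neq0].
  apply: contraTneq => ->; rewrite -leNgt; apply: specnorm_le => // x.
  by rewrite mul0mx norm20 mul0r.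
rewrite lt0r specnorm_ge0 andbT; apply: contra B_neq0 => /eqP B0.
apply/eqP/matrixP => i j; have := norm2_mulmx B (delta_mx j 0).
rewrite B0 mul0r -colE => leN0.
have /eqP : norm2 (col j B) == 0 by rewrite eq_le leN0 norm2_ge0.
by move/eqP; rewrite norm2_eq0 => /eqP/colP/(_ i); rewrite !mxE.
Qed.

Lemma specnormZ_le a B : specnorm (a *: B) <= cabs a * specnorm B.
Proof.
apply: specnorm_le => [|x]; first by rewrite mulr_ge0 ?cabs_ge0 ?specnorm_ge0.
by rewrite -scalemxAl norm2Z -mulrA ler_wpM2l ?cabs_ge0 ?norm2_mulmx.
Qed.

Lemma specnorm_outer (u : 'cV[R[i]]_n) (v : 'rV[R[i]]_n) :
  specnorm (u *m v) <= norm2 u * norm2 v^T.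
Proof.
apply: specnorm_le => [|x]; first by rewrite mulr_ge0 ?norm2_ge0.
rewrite -mulmxA [v *m x]mx11_scalar mul_mx_scalar norm2Z.
by rewrite mulrC -mulrA ler_wpM2l ?norm2_ge0 ?cabs_mulmx.
Qed.

(** For v = B^T x, the number |v|^2 equals x^T B conj(v), hence is at most |x| |B| |v|; divide by
    |v|. *)
Lemma specnorm_tr_le B : specnorm B^T <= specnorm B.
Proof.
apply: specnorm_le => [|x]; first exact: specnorm_ge0.
have [->|Bx_neq0] := eqVneq (B^T *m x) 0.
  by rewrite norm20 mulr_ge0 ?specnorm_ge0 ?norm2_ge0.
rewrite -(ler_pM2r (_ : 0 < norm2 (B^T *m x))) ?norm2_gt0 //.
rewrite -expr2 -[leLHS]ger0_norm ?sqr_ge0 // -cabs_real -mulmx_tr_conj.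
rewrite trmx_mul trmxK -mulmxA; apply: (le_trans (cabs_mulmx _ _)).
rewrite trmxK mulrC [leRHS]mulrAC ler_wpM2r ?norm2_ge0 //.
by apply: (le_trans (norm2_mulmx _ _)); rewrite norm2_conj.
Qed.

Lemma specnorm_tr B : specnorm B^T = specnorm B.
Proof.
by apply/eqP; rewrite eq_le specnorm_tr_le -{1}(trmxK B) specnorm_tr_le.
Qed.
End SpectralNorm.
End Norms.

(** * Simple eigenvalues *)

Section Corank1.
Variables (F : fieldType) (n : nat).
Implicit Types (M E : 'M[F]_n) (x : 'cV[F]_n) (y : 'rV[F]_n).

(** The left kernel has dimension at most one, so [y] spans it. [B] may have several rows, which
    allows whole cokernel matrices to be treated at once. *)
Lemma corank1_left M y p (B : 'M[F]_(p, n)) : (n <= (\rank M).+1)%N ->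
  y != 0 -> y *m M = 0 -> B *m M = 0 -> exists g : 'cV_p, B = g *m y.
Proof.
move=> rkM y_neq0 /sub_kermxP yM /sub_kermxP BM.
apply/submxP; apply: (submx_trans BM).
rewrite -(geq_leqif (mxrank_leqif_sup yM)) mxrank_ker rank_rV y_neq0.
by rewrite leq_subLR addn1.
Qed.

Lemma corank1_right M x p (B : 'M[F]_(n, p)) : (n <= (\rank M).+1)%N ->
  x != 0 -> M *m x = 0 -> M *m B = 0 -> exists g : 'rV_p, B = x *m g.
Proof.
rewrite -mxrank_tr => rkM x_neq0 Mx MB.
have [||| g Bg] := @corank1_left M^T x^T _ B^T rkM.
- by rewrite -trmx0 (inj_eq trmx_inj).
- by rewrite -trmx_mul Mx trmx0.
- by rewrite -trmx_mul MB trmx0.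
by exists g^T; rewrite -(trmxK B) Bg trmx_mul trmxK.
Qed.

(* With [M = Q(delta)] and [E = delta Q'(delta)], all that the condition number
   uses of the simplicity of [delta]. *)
Definition simple_null M E x y : Prop :=
  [/\ M *m x = 0, y *m M = 0,
      forall u : 'cV_n, M *m u = 0 -> exists c, u = c *: x
    & (y *m E *m x) 0 0 != 0].

Lemma simple_null_neq0 M E x y : simple_null M E x y -> (x != 0) /\ (y != 0).
Proof.
case=> _ _ _ yEx; split; apply: contraNneq yEx => ->.
  by rewrite mulmx0 mxE.
by rewrite !mul0mx mxE.
Qed.

(** The columns of [cokermx M] are null vectors of [M], hence multiples of [x], so the cokernel has
    rank at most one. *)
Lemma simple_null_rank M E x y : simple_null M E x y -> (n <= (\rank M).+1)%N.
Proof.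
move=> [Mx yM kerM _]; rewrite -addn1 -leq_subLR -mxrank_coker -mxrank_tr.
suff /mxrankS : ((cokermx M)^T <= x^T)%MS.
  by move=> /leq_trans -> //; rewrite rank_rV leq_b1.
apply/row_subP => j; rewrite -tr_col.
have [|c ->] := kerM (col j (cokermx M)).
  by rewrite colE mulmxA mulmx_coker mul0mx.
by rewrite linearZ scalemx_sub.
Qed.

(** [x *m f] projects onto the line of [x], so [1%:M - x *m f] kills the null space of [M] and
    factors through [M]. A vector with small residual is therefore close to a multiple of [x]. *)
Lemma simple_null_retract M E x y : simple_null M E x y ->
  exists (G : 'M[F]_n) (f : 'rV_n), 1%:M - x *m f = G *m M.
Proof.
move=> sMx; have [x_neq0 _] := simple_null_neq0 sMx.
have rkM := simple_null_rank sMx; have [Mx _ _ _] := sMx.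
have [g Cg] := corank1_right rkM x_neq0 Mx (mulmx_coker M).
have /cV0Pn[i xi_neq0] := x_neq0.
pose f : 'rV_n := (x i 0)^-1 *: delta_mx 0 i.
suff /submxP[G eG] : (1%:M - x *m f <= M)%MS by exists G, f.
rewrite submxE Cg mulmxBl mul1mx -!mulmxA (mulmxA f).
have -> : f *m x = 1%:M.
  rewrite -scalemxAl -rowE [row i x]mx11_scalar mxE.
  by rewrite -mul_scalar_mx -scalar_mxM mulVf.
by rewrite mul1mx subrr.
Qed.

(** Fredholm alternative: the range of [M] is the annihilator of [y]. *)
Lemma simple_null_solve M E x y (e : 'cV_n) : simple_null M E x y ->
  y *m e = 0 -> exists w, M *m w = e.
Proof.
move=> sMx ye; have [_ y_neq0] := simple_null_neq0 sMx.
have rkM := simple_null_rank sMx; have [_ yM _ _] := sMx.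
have [|g Cg] := @corank1_left M y _ (cokermx M^T)^T rkM y_neq0 yM.
  by rewrite -{2}(trmxK M) -trmx_mul mulmx_coker trmx0.
suff /submxP[w ew] : (e^T <= M^T)%MS.
  by exists w^T; rewrite -(trmxK e) ew trmx_mul trmxK.
by rewrite submxE -(trmxK (cokermx _)) Cg -trmx_mul -mulmxA ye mulmx0 trmx0.
Qed.
End Corank1.

Section SimpleEigenvalue.
Variable F : fieldType.

Lemma deriv_mulmx m n p (A : 'M[{poly F}]_(m, n)) (B : 'M[{poly F}]_(n, p)) :
  map_mx (@deriv F) (A *m B)
    = map_mx (@deriv F) A *m B + A *m map_mx (@deriv F) B.
Proof.
apply/matrixP => i j; rewrite !mxE raddf_sum -big_split /=.
by apply: eq_bigr => l _; rewrite !mxE derivM.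
Qed.

Lemma mup1_deriv (p : {poly F}) (a : F) :
  p != 0 -> mup a p = 1%N -> root p a /\ p^`().[a] != 0.
Proof.
move=> p_neq0 mup1.
have : (mup a p <= 1)%N by rewrite mup1.
have : (1 <= mup a p)%N by rewrite mup1.
rewrite mup_leq // mup_geq // expr1 dvdp_XsubCl => p_root sq_ndvd.
split => //; move/factor_theorem: p_root sq_ndvd => [q ->].
rewrite derivM derivXsubC mulr1 hornerD hornerM hornerXsubC subrr mulr0 add0r.
apply: contra => /eqP/rootP/factor_theorem[r ->].
by rewrite expr2 -mulrA dvdp_mull.
Qed.

(** A nonzero entry of the adjugate is, up to sign, a nonzero minor of size n - 1, and an invertible
    submatrix bounds the rank from below. *)
Lemma adjugate_rank n (M : 'M[F]_n) : \adj M != 0 -> (n <= (\rank M).+1)%N.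
Proof.
case: n M => // n M /matrix0Pn[i [j]].
rewrite mxE /cofactor mulf_eq0 signr_eq0 /= => det_neq0.
have : row' j (col' i M) \in unitmx by rewrite unitmxE unitfE.
move/mxrank_unit => /= rk; rewrite ltnS -[leqLHS]rk.
apply: (leq_trans _ (_ : \rank (col' i M) <= \rank M)%N).
  by rewrite row'Esub; apply/mxrankS/row_subP => l; rewrite row_rowsub row_sub.
rewrite -mxrank_tr -[leqRHS]mxrank_tr tr_col' row'Esub.
by apply/mxrankS/row_subP => l; rewrite row_rowsub row_sub.
Qed.

End SimpleEigenvalue.

Section MatPoly.
Variable R : realType.
Variables (d n : nat).
Implicit Types (Q : matpoly R d n) (a : R[i]).

(* [lambda Q'(lambda)]: the factor [lambda] keeps all exponents nonnegative. *)
Definition mpeuler Q a : 'M[R[i]]_n := \sum_(i < d.+1) (i%:R * a ^+ i) *: Q i.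

Lemma simple_eigenvalue_null Q a (x : 'cV_n) : mpregular Q -> a != 0 ->
    simple_eigenvalue Q a -> right_eigenvector Q a x ->
  exists y, simple_null (mpeval Q a) (mpeuler Q a) x y.
Proof.
move=> regQ a_neq0 /(mup1_deriv regQ)[]; rewrite /mpdet.
set P := \sum_(i < _) _.
move=> detP_root; set c := (_).[a] => c_neq0 [x_neq0 Mx].
pose ev p q (A : 'M[{poly R[i]}]_(p, q)) := map_mx (horner_eval a) A.
have evP : ev _ _ P = mpeval Q a.
  rewrite /ev /P map_mx_sum; apply: eq_bigr => i _.
  apply/matrixP => s t; rewrite !mxE /=.
  by rewrite /horner_eval hornerM hornerXn hornerC.
have evP' : a *: ev _ _ (map_mx (@deriv _) P) = mpeuler Q a.
  apply/matrixP => s t; rewrite !mxE /horner_eval !summxE.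
  rewrite raddf_sum horner_sum mulr_sumr; apply: eq_bigr => i _.
  rewrite !mxE /= derivM derivC mulr0 addr0 derivXn hornerM hornerMn hornerXn.
  rewrite hornerC mulrA; congr (_ * _); case: i => -[|i] ltid /=.
    by rewrite mulr0n mul0r mulr0.
  by rewrite mulrnAr -exprS mulr_natl.
set M := mpeval Q a in Mx evP *; set E := mpeuler Q a in evP' *.
have detM : \det M = 0 by rewrite -evP det_map_mx; apply: eqP detP_root.
have [y y_neq0 yM] : exists2 y : 'rV_n, y != 0 & y *m M = 0.
  by apply/det0P; rewrite detM.
(* Differentiating [P * \adj P = \det P] gives
   [y P'(a) (\adj P)(a) = (\det P)'(a) y], so [(\adj P)(a) != 0]. *)
have evN : ev _ _ (\adj P) = \adj M by rewrite -evP /ev map_mx_adj.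
have MN : M *m \adj M = 0.
  by rewrite mul_mx_adj detM; apply/matrixP => s t; rewrite !mxE mul0rn.
have yEN : y *m E *m \adj M = (a * c) *: y.
  rewrite -evP' -scalemxAr -scalemxAl -scalerA; congr (_ *: _).
  have : ev _ _ (map_mx (@deriv _) (P *m \adj P)) = c%:M.
    rewrite mul_mx_adj; apply/matrixP => s t.
    by rewrite !mxE derivMn /horner_eval hornerMn.
  rewrite deriv_mulmx /ev map_mxD !map_mxM -!/(ev _ _ _) evP evN.
  move/(congr1 (mulmx y)).
  by rewrite mulmxDr !mulmxA yM mul0mx addr0 mul_mx_scalar.
have ac_neq0 : a * c != 0 by rewrite mulf_neq0.
have adj_neq0 : \adj M != 0.
  apply: contraNneq y_neq0 => adj0; move/esym/eqP: yEN.
  by rewrite adj0 mulmx0 scaler_eq0 (negPf ac_neq0).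
have rkM := adjugate_rank adj_neq0.
have ker p (B : 'M[R[i]]_(n, p)) := @corank1_right _ _ M x p B rkM x_neq0 Mx.
exists y; split => // [u /ker[g ->]|].
  by exists (g 0 0); rewrite [g]mx11_scalar mul_mx_scalar mxE eqxx mulr1n.
(* All columns of [\adj M] are multiples of [x]; if [y *m E *m x] were zero, so would be
   [y *m E *m \adj M]. *)
have [g Ng] := ker _ _ MN; apply: contraNneq y_neq0 => yEx0.
move/esym/eqP: yEN; rewrite Ng mulmxA [_ *m x]mx11_scalar yEx0.
by rewrite mul_scalar_mx scale0r scaler_eq0 (negPf ac_neq0).
Qed.
End MatPoly.

Ltac nonneg := try assumption; lazymatch goal with
  | |- is_true (0 <= _ * _) => apply: mulr_ge0; nonneg
  | |- is_true (0 <= _ + _) => apply: addr_ge0; nonneg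
  | |- is_true (0 <= _ ^-1) => rewrite invr_ge0; nonneg
  | |- is_true (0 <= _ ^+ _) => apply: exprn_ge0; nonneg
  | |- is_true (0 <= cabs _) => apply: cabs_ge0
  | |- is_true (0 <= norm2 _) => apply: norm2_ge0
  | |- is_true (0 <= specnorm _) => apply: specnorm_ge0
  | |- is_true (0 <= _%:R) => apply: ler0n
  | |- _ => try done
  end.

Lemma subD_addD (V : zmodType) (v p q r : V) :
  v = v - p - (q + r) + (p + q) + r.
Proof.
by rewrite -(addrA v) -opprD -[RHS]addrA -(addrA p) subrK.
Qed.

(** * The condition number of a simple eigenvalue *)

Section Perturbation.
Variables (R : realType) (d n : nat).
Implicit Types (Q dQ : matpoly R d n) (a t : R[i]) (u : 'cV[R[i]]_n).

Lemma exprD_taylor a i : a != 0 -> exists2 C : R, 0 <= C & forall t,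
  cabs t <= 1 ->
  cabs ((a + t) ^+ i - a ^+ i - (t / a) * (i%:R * a ^+ i)) <= C * cabs t ^+ 2.
Proof.
move=> a_neq0; elim: i => [|i [C C_ge0 leC]].
  by exists 0 => // t _; rewrite !expr0 subrr mul0r mulr0 subrr cabs0 mul0r.
exists ((cabs a + 1) * C + cabs (i%:R * a ^+ i / a)) => [|t t_le1].
  by nonneg.
(* The new remainder is [a + t] times the old one plus the term i a^(i-1) t^2. *)
have -> : (a + t) ^+ i.+1 - a ^+ i.+1 - t / a * (i.+1%:R * a ^+ i.+1)
    = (a + t) * ((a + t) ^+ i - a ^+ i - t / a * (i%:R * a ^+ i))
      + i%:R * a ^+ i / a * t ^+ 2.
  by rewrite !exprS -[i.+1%:R]natr1 -mulrA; field.
apply: (le_trans (ler_cabsD _ _)); rewrite [leRHS]mulrDl lerD //; last first.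
  by rewrite cabsM cabsX.
rewrite cabsM -[leRHS]mulrA ler_pM ?cabs_ge0 ?leC //.
by apply: (le_trans (ler_cabsD _ _)); rewrite lerD2l.
Qed.

Lemma mpeval_taylor Q a : a != 0 -> exists2 C : R, 0 <= C & forall t u,
  cabs t <= 1 ->
  norm2 ((mpeval Q (a + t) - mpeval Q a - (t / a) *: mpeuler Q a) *m u)
    <= C * cabs t ^+ 2 * norm2 u.
Proof.
move=> a_neq0.
have /choice[c cP] i : exists c : R, 0 <= c /\ forall t, cabs t <= 1 ->
    cabs ((a + t) ^+ i - a ^+ i - (t / a) * (i%:R * a ^+ i)) <= c * cabs t ^+ 2.
  by have [c c_ge0 lec] := exprD_taylor i a_neq0; exists c.
exists (\sum_(i < d.+1) c i * specnorm (Q i)) => [|t u t_le1].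
  by apply: sumr_ge0 => i _; rewrite mulr_ge0 ?specnorm_ge0 //; case: (cP i).
have -> : mpeval Q (a + t) - mpeval Q a - (t / a) *: mpeuler Q a
    = \sum_(i < d.+1)
        ((a + t) ^+ i - a ^+ i - (t / a) * (i%:R * a ^+ i)) *: Q i.
  rewrite /mpeval /mpeuler scaler_sumr -!sumrB; apply: eq_bigr => i _.
  by rewrite !scalerBl scalerA.
rewrite mulmx_suml !mulr_suml; apply: (le_trans (ler_norm2_sum _)).
apply: ler_sum => i _; rewrite -scalemxAl norm2Z.
rewrite [c i * _ * _]mulrAC -[leRHS]mulrA; case: (cP i) => c_ge0 leci.
by apply: ler_pM; rewrite ?cabs_ge0 ?norm2_ge0 ?norm2_mulmx ?leci.
Qed.

(** At s = |delta| this is the weight sum in the numerator of the condition number; [s] is free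
    because the estimates also need it at nearby radii. *)
Definition mpnorm Q (s : R) : R := \sum_(i < d.+1) s ^+ i * specnorm (Q i).

Lemma mpnorm_ge0 Q s : 0 <= s -> 0 <= mpnorm Q s.
Proof.
move=> s_ge0; apply: sumr_ge0 => i _.
by rewrite mulr_ge0 ?exprn_ge0 ?specnorm_ge0.
Qed.

Lemma ler_mpnorm Q s s' : 0 <= s -> s <= s' -> mpnorm Q s <= mpnorm Q s'.
Proof.
move=> s_ge0 le_ss'; apply: ler_sum => i _; rewrite ler_wpM2r ?specnorm_ge0 //.
by rewrite lerXn2r ?nnegrE // (le_trans s_ge0).
Qed.

Lemma norm2_mpeval Q (z : R[i]) u :
  norm2 (mpeval Q z *m u) <= mpnorm Q (cabs z) * norm2 u.
Proof.
rewrite mulmx_suml mulr_suml; apply: (le_trans (ler_norm2_sum _)).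
apply: ler_sum => i _; rewrite -scalemxAl norm2Z cabsX -mulrA.
by rewrite ler_wpM2l ?exprn_ge0 ?cabs_ge0 ?norm2_mulmx.
Qed.

Lemma norm2_perturbation Q dQ (eps s : R) (z : R[i]) u : 0 <= eps ->
    (forall i, specnorm (dQ i) <= eps * specnorm (Q i)) -> cabs z <= s ->
  norm2 (mpeval dQ z *m u) <= eps * mpnorm Q s * norm2 u.
Proof.
move=> eps_ge0 dQ_le zs; apply: (le_trans (norm2_mpeval _ _ _)).
rewrite ler_wpM2r ?norm2_ge0 //.
apply: (@le_trans _ _ (eps * mpnorm Q (cabs z))); last first.
  by rewrite ler_wpM2l // ler_mpnorm ?cabs_ge0.
rewrite mulr_sumr; apply: ler_sum => i _; rewrite mulrCA.
by rewrite ler_wpM2l ?exprn_ge0 ?cabs_ge0.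
Qed.

(** The bound [r] on [dx] does not shrink with [eps]. Hence [u = x + dx] is compared not with [x]
    but with its component [c *: x], and the inequality is divided by |c|. A single [K], chosen
    before [r], [eps] and [tau], governs all error terms, so that the sharp bound is left as [eps]
    tends to 0. *)
Lemma perturbation_upper Q a (x : 'cV_n) (y : 'rV_n) : a != 0 ->
    simple_null (mpeval Q a) (mpeuler Q a) x y ->
  exists r0 K : R, [/\ 0 < r0, 0 <= K & forall r eps tau : R,
    0 < r <= r0 -> 0 < eps -> K * eps <= 1 ->
    perturbation_ratios Q a x r eps tau ->
    tau * (cabs ((y *m mpeuler Q a *m x) 0 0) - K * eps)
      <= K * eps
         + norm2 y^T * mpnorm Q (cabs a + K * eps) * (norm2 x + K * eps)].
Proof.
move=> a_neq0 sQx; have [x_neq0 y_neq0] := simple_null_neq0 sQx.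
have [G [f Gf]] := simple_null_retract sQx; have [Qx yQ _ yEx] := sQx.
have [C C_ge0 leC] := mpeval_taylor Q a_neq0.
set E := mpeuler Q a in yEx leC *; set b := cabs _.
set al := cabs a; set Nx := norm2 x; set Ny := norm2 y^T.
have [SE SE_ge0 leSE] := norm2_mulmx_bounded E.
have [SG SG_ge0 leSG] := norm2_mulmx_bounded G.
have al_gt0 : 0 < al by rewrite cabs_gt0.
have Nx_gt0 : 0 < Nx by rewrite norm2_gt0.
have [al_ge0 Nx_ge0] := (ltW al_gt0, ltW Nx_gt0).
have Ny_ge0 : 0 <= Ny := norm2_ge0 _.
have b_gt0 : 0 < b by rewrite cabs_gt0.
have b_ge0 := ltW b_gt0.
pose X := Nx + 1; have X_ge0 : 0 <= X by rewrite /X; nonneg.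
(* [S1], like [SE] and [SG], is kept abstract: unification unfolds [specnorm]
   when it compares two norms. *)
have [S1 S1E] : exists s, mpnorm Q (al + 1) = s by exists (mpnorm Q (al + 1)).
have S1_ge0 : 0 <= S1 by rewrite -S1E mpnorm_ge0 ?addr_ge0.
(* [D * r] gathers the terms of the estimate of |t| that carry an extra factor [r]; the radius
   chosen below makes it at most b / 2, so half of [T * b] survives. *)
pose D := Ny * SE + al * Ny * C * X.
have D_ge0 : 0 <= D by rewrite /D; nonneg.
have DE : D = Ny * SE + al * Ny * C * X by [].
(* [C1 * eps] bounds |t|, [C2 * eps] the norm of [mpeval Q a *m u], and [C3 * eps] the distance from
   [u] to the line of [x]; [K3] and [K4] are the losses in the pairing with [E] and in the Taylor
   remainder. The last three enter [K] doubled because |c| is only known to be at least 1/2, a bound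
   secured by [4 * C3 / Nx]. *)
pose C1 := 2 * al * Ny * S1 * X / b.
have C1_ge0 : 0 <= C1 by rewrite /C1; nonneg.
pose C2 := (C1 * (SE / al + C) + S1) * X.
have C2_ge0 : 0 <= C2 by rewrite /C2; nonneg.
pose C3 := SG * C2; have C3_ge0 : 0 <= C3 by rewrite /C3; nonneg.
pose K3 := Ny * SE * C3; have K3_ge0 : 0 <= K3 by rewrite /K3; nonneg.
pose K4 := Ny * C * C1 ^+ 2 * X.
have K4_ge0 : 0 <= K4 by rewrite /K4; nonneg.
pose K := C1 + 2 * C3 + 2 * K3 + 2 * K4 + 4 * C3 / Nx.
have K5_ge0 : 0 <= 4 * C3 / Nx by nonneg.
have K_ge0 : 0 <= K by rewrite /K; nonneg.
have r0_gt0 : 0 < Num.min 1 (Num.min (Nx / 4) (b / (2 * (D + 1)))).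
  by rewrite !lt_min ltr01 !divr_gt0 ?mulr_gt0 ?ltr_wpDl.
have C1E : C1 * b = 2 * al * Ny * S1 * X by rewrite divfK ?gt_eqF.
have C2E : C2 = (C1 * (SE / al + C) + S1) * X by [].
have C3E : C3 = SG * C2 by [].
have K3E : K3 = Ny * SE * C3 by [].
have K4E : K4 = Ny * C * C1 ^+ 2 * X by [].
have leC1K : C1 <= K by rewrite /K -!addrA lerDl; nonneg.
have leC3K : 2 * C3 <= K.
  by rewrite /K; clear - C1_ge0 K3_ge0 K4_ge0 K5_ge0; lra.
have leK3K : 2 * K3 <= K.
  by rewrite /K; clear - C1_ge0 C3_ge0 K4_ge0 K5_ge0; lra.
have leK4K : 2 * K4 <= K.
  by rewrite /K; clear - C1_ge0 K3_ge0 C3_ge0 K5_ge0; lra.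
have leC3N : 4 * C3 <= K * Nx.
  by rewrite -ler_pdivrMr // /K lerDr; nonneg.
clearbody K K4 K3 C3 C2 C1 D.
exists (Num.min 1 (Num.min (Nx / 4) (b / (2 * (D + 1))))), K.
split => // r eps tau /andP[r_gt0].
rewrite !le_min => /and3P[r_le1 r_leN r_leD] eps_gt0 Keps_le1.
case=> dQ [t [dx [dQ_le t_le dx_le QdQ tauE]]].
set u := x + dx in QdQ; set T := cabs t in t_le tauE; set U := norm2 u.
have eps_ge0 := ltW eps_gt0.
have T_ge0 : 0 <= T := cabs_ge0 _; have U_ge0 : 0 <= U := norm2_ge0 _.
have T_le1 : T <= 1 := le_trans t_le r_le1.
have mu_le : cabs (a + t) <= al + T := ler_cabsD _ _.
have U_le : U <= X.
  apply: (le_trans (ler_norm2D _ _)); rewrite lerD2l.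
  exact: (le_trans dx_le r_le1).
have U_ge : Nx - r <= U.
  by apply: (le_trans _ (ler_norm2B x dx)); rewrite lerD2l lerN2.
pose Rem := mpeval Q (a + t) - mpeval Q a - (t / a) *: E.
have Rem_le : norm2 (Rem *m u) <= C * T ^+ 2 * U := leC t u T_le1.
have dQ_norm (s : R) : al + T <= s ->
    norm2 (mpeval dQ (a + t) *m u) <= eps * mpnorm Q s * U.
  move=> le_s; apply: norm2_perturbation dQ_le (le_trans mu_le le_s).
  exact: ltW.
have QdQ' : mpeval Q a *m u + (t / a) *: (E *m u) + Rem *m u
    + mpeval dQ (a + t) *m u = 0.
  rewrite scalemxAl -!mulmxDl -[RHS]QdQ; congr ((_ + _) *m _).
  by rewrite /Rem -(addrA _ (- _)) -opprD [LHS]addrC subrK.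
(* [y] annihilates [Q(a)], hence [t y E u / a] is of second order up to the
   perturbation; this bounds [T] by [C1 eps] first, and by the sharp constant
   once [u] is known to be [c x + O(eps)]. *)
set g := cabs ((y *m E *m u) 0 0).
have main (s : R) : al + T <= s ->
    T * g <= al * (Ny * (C * T ^+ 2 * U + eps * mpnorm Q s * U)).
  move=> le_s; rewrite -ler_pdivrMl //.
  have -> : al^-1 * (T * g) = cabs ((y *m (Rem *m u
      + mpeval dQ (a + t) *m u)) 0 0).
    have -> : Rem *m u + mpeval dQ (a + t) *m u
        = - (mpeval Q a *m u + (t / a) *: (E *m u)).
      by apply/eqP; rewrite -addr_eq0 addrC addrA; apply/eqP.
    rewrite mulmxN mulmxDr (mulmxA _ (mpeval Q a)) yQ mul0mx add0r -scalemxAr.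
    rewrite mulmxA !mxE cabsN cabsM cabsM cabsV -/al -/T.
    by rewrite mulrA [al^-1 * _]mulrC /g mxE.
  apply: (le_trans (cabs_mulmx _ _)); rewrite ler_wpM2l //.
  by apply: (le_trans (ler_norm2D _ _)); rewrite lerD ?dQ_norm.
have g_ge : b - Ny * SE * r <= g.
  rewrite /g /u mulmxDr mxE; apply: le_trans (lerB_cabsD _ _).
  rewrite lerD2l lerN2 -mulmxA; apply: (le_trans (cabs_mulmx _ _)).
  rewrite -mulrA ler_wpM2l //; apply: (le_trans (leSE _)).
  by rewrite ler_wpM2l.
have Dr_le : D * r <= b / 2.
  apply: (le_trans (ler_wpM2l D_ge0 r_leD)).
  by rewrite mulrA ler_pdivrMr ?mulr_gt0 ?ltr_wpDl //; clear - b_ge0; lra.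
have T_le : T <= C1 * eps.
  rewrite -(ler_pM2r b_gt0) mulrAC C1E.
  have h1 : T * (b - Ny * SE * r) <= T * g by rewrite ler_wpM2l.
  have h2 := main (al + 1) ltac:(by rewrite lerD2l).
  have h3 : C * T ^+ 2 * U + eps * S1 * U
      <= C * (T * r) * X + eps * S1 * X.
    apply: lerD; first by rewrite expr2 !ler_pM ?mulr_ge0 // ler_wpM2l.
    by rewrite ler_wpM2l //; nonneg.
  have h4 := ler_wpM2l al_ge0 (ler_wpM2l Ny_ge0 h3).
  have h5 := ler_wpM2l T_ge0 Dr_le.
  rewrite DE in h5; rewrite S1E in h2.
  by clear - h1 h2 h4 h5; lra.
have Qu_le : norm2 (mpeval Q a *m u) <= C2 * eps.
  have -> : mpeval Q a *m u
      = - ((t / a) *: (E *m u) + Rem *m u + mpeval dQ (a + t) *m u).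
    by apply/eqP; rewrite -addr_eq0 !addrA; apply/eqP.
  rewrite norm2N; apply: (le_trans (ler_norm2D _ _)).
  have h1 := dQ_norm (al + 1) ltac:(by rewrite lerD2l).
  have h2 := ler_norm2D ((t / a) *: (E *m u)) (Rem *m u).
  have h3 : norm2 ((t / a) *: (E *m u)) <= C1 * eps / al * (SE * X).
    rewrite norm2Z cabsM cabsV; apply: ler_pM; nonneg.
      by rewrite ler_wpM2r ?invr_ge0.
    by apply: (le_trans (leSE _)); rewrite ler_wpM2l.
  have h4 : C * T ^+ 2 * U <= C * (C1 * eps * 1) * X.
    by rewrite expr2 !ler_pM ?mulr_ge0 // ler_wpM2l // ler_pM.
  have h5 : eps * S1 * U <= eps * S1 * X.
    by rewrite ler_wpM2l //; nonneg.
  rewrite S1E in h1; rewrite C2E.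
  by clear - h1 h2 h3 h4 h5 Rem_le; lra.
pose c := (f *m u) 0 0; pose cc := cabs c.
have uE : u - c *: x = G *m (mpeval Q a *m u).
  rewrite mulmxA -Gf mulmxBl mul1mx -mulmxA [f *m u]mx11_scalar.
  by rewrite mul_mx_scalar.
have V_le : norm2 (u - c *: x) <= C3 * eps.
  rewrite uE C3E -mulrA; apply: (le_trans (leSG _)).
  by rewrite ler_wpM2l.
have uD : u = c *: x + (u - c *: x) by rewrite addrC subrK.
have U_le2 : U <= cc * Nx + C3 * eps.
  rewrite /U {1}uD; apply: (le_trans (ler_norm2D _ _)).
  by rewrite norm2Z lerD.
have g_ge2 : cc * b - K3 * eps <= g.
  rewrite /g {1}uD mulmxDr mxE.
  apply: le_trans (lerB_cabsD _ _).
  rewrite -scalemxAr mxE cabsM lerD2l lerN2 -mulmxA.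
  apply: (le_trans (cabs_mulmx _ _)).
  rewrite K3E -[Ny * SE * C3]mulrA -[leRHS]mulrA ler_wpM2l //.
  apply: (le_trans (leSE _)).
  by rewrite -[leRHS]mulrA ler_wpM2l.
(* Both [r] and [C3 * eps] are at most [Nx / 4], so |c| Nx >= U - Nx / 4 >= Nx / 2. *)
have cc_ge : 1 / 2 <= cc.
  rewrite -(ler_pM2r Nx_gt0).
  have h1 : 4 * (C3 * eps) <= Nx.
    have h2 : 4 * C3 * eps <= K * Nx * eps by rewrite ler_wpM2r.
    have h3 : K * eps * Nx <= 1 * Nx by rewrite ler_wpM2r.
    by clear - h2 h3; lra.
  by clear - h1 U_ge r_leN U_le2; lra.
pose s1 := mpnorm Q (al + C1 * eps).
have s1_ge0 : 0 <= s1 by rewrite mpnorm_ge0 //; nonneg.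
have tau_ge0 : 0 <= tau by rewrite tauE; nonneg.
have TE : T = tau * (eps * al) by rewrite tauE divfK ?gt_eqF ?mulr_gt0.
have tau_le : tau * al <= C1.
  by rewrite -(ler_pM2r eps_gt0) -mulrA [al * _]mulrC -TE.
have tau_g : tau * g <= Ny * (C * (C1 * eps * C1) * X + s1 * U).
  have h1 := main (al + C1 * eps) ltac:(by rewrite lerD2l).
  rewrite -(ler_pM2l (_ : 0 < eps * al)) ?mulr_gt0 //.
  have -> : eps * al * (tau * g) = T * g by rewrite TE; ring.
  apply: (le_trans h1); rewrite -/s1.
  have -> : eps * al * (Ny * (C * (C1 * eps * C1) * X + s1 * U)) =
    al * (Ny * (C * (C1 * eps * C1) * X * eps + eps * s1 * U)) by ring.
  rewrite ler_wpM2l // ler_wpM2l // lerD2r.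
  have -> : C * T ^+ 2 * U = C * (T * (tau * al)) * U * eps.
    by rewrite expr2 {2}TE; ring.
  rewrite ler_wpM2r // ler_pM //; nonneg.
  rewrite ler_wpM2l // ler_pM //; nonneg.
have cc_gt0 : 0 < cc by apply: lt_le_trans cc_ge; rewrite divr_gt0.
have le_ccK (s : R) : 2 * s <= K -> s * eps <= cc * (K * eps).
  move=> leK; rewrite [leRHS]mulrA ler_wpM2r //.
  have ccK_ge : 1 / 2 * K <= cc * K by rewrite ler_wpM2r.
  by clear - ccK_ge leK; lra.
have [K3_le K4_le C3_le] :=
  And3 (le_ccK K3 leK3K) (le_ccK K4 leK4K) (le_ccK C3 leC3K).
have s1_le : s1 <= mpnorm Q (al + K * eps).
  by rewrite ler_mpnorm // ?lerD2l ?ler_wpM2r //; nonneg.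
rewrite -(ler_pM2l cc_gt0).
have h1 : tau * (cc * b - cc * (K * eps)) <= tau * g.
  by rewrite ler_wpM2l // (le_trans _ g_ge2) // lerD2l lerN2.
have h2 : Ny * (s1 * U)
    <= Ny * (mpnorm Q (al + K * eps) * (cc * Nx + cc * (K * eps))).
  by rewrite ler_wpM2l // ler_pM // (le_trans U_le2) // lerD2l.
rewrite K4E in K4_le.
by clear - tau_g h1 h2 K4_le; lra.
Qed.

(* The rank-one perturbations [- c_i * (Q(mu) u) u^*] cancel the residual of
   [(mu, u)]; the unimodular factors align all the terms of the sum. *)
Lemma backward_error Q (mu : R[i]) u (eps : R) : mu != 0 -> u != 0 ->
    0 < mpnorm Q (cabs mu) ->
    norm2 (mpeval Q mu *m u) <= eps * mpnorm Q (cabs mu) * norm2 u ->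
  exists dQ, (forall i, specnorm (dQ i) <= eps * specnorm (Q i))
    /\ (mpeval Q mu + mpeval dQ mu) *m u = 0.
Proof.
move=> mu_neq0 u_neq0 sg_gt0 res_le; set sg := mpnorm _ _ in sg_gt0 res_le.
set rho := mpeval Q mu *m u in res_le *; pose us := (map_mx (@conjc R) u)^T.
have mu_gt0 : 0 < cabs mu by rewrite cabs_gt0.
have Nu_gt0 : 0 < norm2 u by rewrite norm2_gt0.
pose rc (s : R) : R[i] := real_complex R s.
(* As [us *m u] is [norm2 u ^+ 2], the products [cabs mu ^+ i * w i * norm2 u ^+ 2] sum to 1 and the
   residual cancels exactly. *)
pose w i : R := specnorm (Q i) / sg / norm2 u ^+ 2.
have w_ge0 i : 0 <= w i by rewrite /w !divr_ge0 ?specnorm_ge0 ?exprn_ge0 // ltW.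
exists (fun i : 'I_d.+1 => (- (conjc mu ^+ i / rc (cabs mu ^+ i) * rc (w i)))
  *: (rho *m us)); split => [i|].
  apply: (le_trans (specnormZ_le _ _)).
  have ->: cabs (- (conjc mu ^+ i / rc (cabs mu ^+ i) * rc (w i))) = w i.
    rewrite cabsN !cabsM cabsV cabsX cabsJ !cabs_real !ger0_norm //.
      by rewrite divff ?mul1r // expf_neq0 // gt_eqF.
    by rewrite exprn_ge0 // cabs_ge0.
  apply: (@le_trans _ _ (w i * (norm2 rho * norm2 u))).
    rewrite ler_wpM2l //; apply: (le_trans (specnorm_outer _ _)).
    by rewrite trmxK norm2_conj.
  have -> : w i * (norm2 rho * norm2 u)
      = specnorm (Q i) * (norm2 rho / (sg * norm2 u)).
    by rewrite /w; field; rewrite !gt_eqF.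
  rewrite mulrC ler_wpM2r ?specnorm_ge0 // ler_pdivrMr ?mulr_gt0 //.
  by rewrite mulrA.
rewrite mulmxDl -/rho /mpeval mulmx_suml.
rewrite (eq_bigr (fun i : 'I_d.+1 =>
  rc (- (cabs mu ^+ i * specnorm (Q i) / sg)) *: rho)) => [|i _]; last first.
  rewrite -!scalemxAl -mulmxA !scalerA.
  have -> : us *m u = (rc (norm2 u ^+ 2))%:M.
    rewrite [LHS]mx11_scalar; congr (_%:M).
    by rewrite /us -[X in _ *m X]trmxK -trmx_mul mxE mulmx_tr_conj.
  rewrite mul_mx_scalar !scalerA; congr (_ *: _).
  have -> : mu ^+ i * - (conjc mu ^+ i / rc (cabs mu ^+ i) * rc (w i))
      * rc (norm2 u ^+ 2)
    = - ((mu * conjc mu) ^+ i / rc (cabs mu ^+ i)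
         * rc (w i) * rc (norm2 u ^+ 2)) by rewrite exprMn; ring.
  rewrite mulcJ -/(rc _) /rc -!rmorphXn -!rmorphV ?unitfE ?expf_neq0 ?gt_eqF //.
  rewrite -!rmorphM -rmorphN; congr (real_complex R _).
  have mui_neq0 : cabs mu ^+ i != 0 by rewrite expf_neq0 ?gt_eqF.
  rewrite exprAC /w; move: (cabs mu ^+ i) mui_neq0 => m m_neq0.
  by field; rewrite m_neq0 !gt_eqF.
rewrite -scaler_suml -rmorph_sum /= sumrN -mulr_suml -/(mpnorm _ _) -/sg.
by rewrite divff ?gt_eqF // rmorphN rmorph1 scaleN1r subrr.
Qed.

(** The shift of the eigenvalue is the real number [eps * cabs a * th], so that its ratio is exactly
    [th]. To first order the residual of the shifted pair is [eps * th * b / Ny], within reach of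
    [backward_error] once [th * b / Ny] is below [mpnorm Q (cabs a) * norm2 x]; the last hypothesis
    is this inequality with its error terms. *)
Lemma perturbation_lower Q a (x : 'cV_n) (y : 'rV_n) : a != 0 ->
    simple_null (mpeval Q a) (mpeuler Q a) x y ->
  exists2 K : R, 0 <= K & forall r eps th : R, 0 < eps -> 0 <= th ->
    eps * cabs a * th <= r -> K * (eps * cabs a * th) <= r ->
    eps * cabs a * th <= 1 -> eps * cabs a * th < cabs a ->
    K * (eps * cabs a * th) < norm2 x ->
    0 < mpnorm Q (cabs a - eps * cabs a * th) ->
    th * cabs ((y *m mpeuler Q a *m x) 0 0) / norm2 y^T
        + K * th * (eps * cabs a * th)
      <= mpnorm Q (cabs a - eps * cabs a * th)
         * (norm2 x - K * (eps * cabs a * th)) ->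
    perturbation_ratios Q a x r eps th.
Proof.
move=> a_neq0 sQx; have [x_neq0 y_neq0] := simple_null_neq0 sQx.
have [C C_ge0 leC] := mpeval_taylor Q a_neq0.
set E := mpeuler Q a in leC *; set b := cabs ((y *m E *m x) 0 0).
pose ys := map_mx (@conjc R) y^T; pose Ny := norm2 y^T.
have Ny_gt0 : 0 < Ny.
  by rewrite norm2_gt0 -trmx0 (inj_eq trmx_inj).
have yys : y *m ys = (real_complex R (Ny ^+ 2))%:M.
  by rewrite [LHS]mx11_scalar -mulmx_tr_conj trmxK.
(* Among vectors with a given product with [y], the multiple of [ys] is shortest. The coefficient
   [be] makes the right-hand side below annihilated by [y], hence an element of the range of
   [mpeval Q a]. *)
pose be : R[i] := a^-1 * (y *m E *m x) 0 0 / real_complex R (Ny ^+ 2).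
(* With this [w], [Q(a + t) (x + t w) = t be y^* + O(t^2)]: the residual is
   minimal to first order. *)
have [w Qw] : exists w, mpeval Q a *m w = be *: ys - a^-1 *: (E *m x).
  apply: (simple_null_solve sQx).
  rewrite mulmxBr -!scalemxAr yys mulmxA [y *m E *m x]mx11_scalar.
  rewrite !scale_scalar_mx -raddfB /= /be divfK ?subrr ?raddf0 //.
  by rewrite fmorph_eq0 expf_neq0 // gt_eqF.
set al := cabs a; have al_gt0 : 0 < al by rewrite cabs_gt0.
have [Qx _ _ _] := sQx.
have [Nx Nx_ge0 NxE] : exists2 s, 0 <= s & norm2 x = s.
  by exists (norm2 x); first exact: norm2_ge0.
have [Nw Nw_ge0 NwE] : exists2 s, 0 <= s & norm2 w = s.
  by exists (norm2 w); first exact: norm2_ge0.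
have [NE NE_ge0 NEE] : exists2 s, 0 <= s & norm2 (E *m w) = s.
  by exists (norm2 (E *m w)); first exact: norm2_ge0.
have al_ge0 := ltW al_gt0.
(* [K0] bounds the second-order residual. In the final constant, [Nw] measures the shift of the
   eigenvector and [al * K0] absorbs [s ^+ 2 = eps * al * th * s]. *)
pose K0 := C * (Nx + Nw) + NE / al.
have K0_ge0 : 0 <= K0 by rewrite /K0; nonneg.
exists (Nw + al * K0) => [|r eps th eps_gt0 th_ge0]; first by nonneg.
rewrite NxE; set s := eps * al * th; set K := Nw + al * K0.
have eps_ge0 := ltW eps_gt0.
have s_ge0 : 0 <= s by rewrite /s; nonneg.
have leNwK : Nw * s <= K * s by rewrite ler_wpM2r // lerDl; nonneg.
move=> s_le_r Ks_le_r s_le1 s_lt_al Ks_lt sg_gt0 le_main.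
pose t := real_complex R s; pose u := x + t *: w; pose mu := a + t.
have t_abs : cabs t = s by rewrite cabs_real ger0_norm.
have u_ge : Nx - K * s <= norm2 u.
  apply: (le_trans _ (ler_norm2B _ _)).
  by rewrite NxE norm2Z t_abs NwE lerD2l lerN2 mulrC.
have mu_ge : al - s <= cabs mu by rewrite -t_abs lerB_cabsD.
have als_ge0 : 0 <= al - s by rewrite subr_ge0 ltW.
have sg_le : mpnorm Q (al - s) <= mpnorm Q (cabs mu) by rewrite ler_mpnorm.
have u_le : norm2 u <= Nx + Nw.
  apply: (le_trans (ler_norm2D _ _)); rewrite NxE norm2Z t_abs NwE lerD2l.
  by rewrite ler_piMl.
have resE : mpeval Q mu *m u = (mpeval Q mu - mpeval Q a - (t / a) *: E) *m u
    + (t * be) *: ys + (t ^+ 2 / a) *: (E *m w).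
  have -> : (t * be) *: ys = mpeval Q a *m u + (t / a) *: (E *m x).
    by rewrite /u mulmxDr Qx add0r -scalemxAr Qw scalerBr !scalerA subrK.
  have Eu : (t / a) *: E *m u
      = (t / a) *: (E *m x) + (t ^+ 2 / a) *: (E *m w).
    by rewrite -scalemxAl mulmxDr scalerDr -scalemxAr scalerA mulrAC.
  by rewrite !mulmxBl Eu; apply: subD_addD.
have res_le : norm2 (mpeval Q mu *m u) <= eps * (th * b / Ny + K * th * s).
  rewrite resE; apply: (le_trans (ler_norm2D _ _)).
  have h1 := ler_norm2D ((mpeval Q mu - mpeval Q a - (t / a) *: E) *m u)
    ((t * be) *: ys).
  have h2 := leC t u ltac:(by rewrite t_abs).
  have h3 : C * s ^+ 2 * norm2 u <= C * s ^+ 2 * (Nx + Nw).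
    by rewrite ler_wpM2l //; nonneg.
  have h4 : norm2 ((t * be) *: ys) = s * (b / (al * Ny)).
    rewrite norm2Z norm2_conj -/Ny !cabsM !cabsV t_abs cabs_real -/al -/b.
    by rewrite ger0_norm ?exprn_ge0 ?ltW //; field; rewrite !gt_eqF.
  have h5 : norm2 ((t ^+ 2 / a) *: (E *m w)) = s ^+ 2 * (NE / al).
    by rewrite norm2Z cabsM cabsX cabsV t_abs NEE -mulrA [_ / al]mulrC.
  have h6 : eps * (th * b / Ny + K * th * s) = s * (b / (al * Ny))
      + s ^+ 2 * K0 + eps * Nw * th * s.
    by rewrite /K /s; field; rewrite !gt_eqF.
  have h7 : 0 <= eps * Nw * th * s by nonneg.
  rewrite h4 in h1; rewrite t_abs in h2; rewrite h6 h5 /K0.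
  by clear - h1 h2 h3 h7; lra.
have mu_neq0 : mu != 0.
  by rewrite -cabs_gt0 (lt_le_trans _ mu_ge) // subr_gt0.
have u_neq0 : u != 0 by rewrite -norm2_gt0 (lt_le_trans _ u_ge) // subr_gt0.
have [| | dQ [dQ_le QdQ]] := @backward_error Q mu u eps mu_neq0 u_neq0.
- exact: lt_le_trans sg_le.
- apply: (le_trans res_le); rewrite -[leRHS]mulrA ler_wpM2l //.
  apply: (le_trans le_main); apply: ler_pM => //; first exact: ltW.
  by rewrite subr_ge0 ltW.
exists dQ, t, (t *: w); split => //; first by rewrite t_abs.
  by rewrite norm2Z t_abs NwE mulrC (le_trans leNwK).
by rewrite t_abs /s [_ * th]mulrC mulfK // mulf_neq0 ?gt_eqF.
Qed.

Lemma cvg_mpnorm Q (f : R -> R) (s : R) (F : set_system R) : Filter F ->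
  f e @[e --> F] --> s -> mpnorm Q (f e) @[e --> F] --> mpnorm Q s.
Proof.
move=> FF fs; rewrite /mpnorm.
apply: cvg_big => [|i _]; first exact: add_continuous.
apply: cvgM; last exact: cvg_cst.
exact: (cvg_comp _ _ fs (@exprn_continuous _ i s)).
Qed.

Lemma mpnorm_gt0 Q a (x : 'cV_n) (y : 'rV_n) : a != 0 ->
  simple_null (mpeval Q a) (mpeuler Q a) x y -> 0 < mpnorm Q (cabs a).
Proof.
move=> a_neq0 [_ _ _ yEx].
rewrite lt0r mpnorm_ge0 ?andbT ?cabs_ge0 //; apply: contraNneq yEx => sg0.
have Q0 i : Q i = 0.
  have /eqP := sg0; rewrite psumr_eq0 => [/allP/(_ i)|j _]; last first.
    by rewrite mulr_ge0 ?exprn_ge0 ?cabs_ge0 ?specnorm_ge0.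
  rewrite mem_index_enum => /(_ isT) /=.
  rewrite mulf_eq0 expf_eq0 cabs_eq0 (negPf a_neq0) andbF /=.
  by apply: contraTeq => Qi; rewrite gt_eqF // specnorm_gt0.
rewrite /mpeuler big1 => [|i _]; last by rewrite Q0 scaler0.
by rewrite mulmx0 mul0mx mxE.
Qed.

(** The factor |delta| of the classical denominator sits in [mpeuler]. For each [eta] the supremum
    eventually lies within [eta] of [ka]; this holds for every radius up to [r0], so the outer limit
    is that of an eventually constant function. *)
Lemma condnumE Q a (x : 'cV_n) (y : 'rV_n) : a != 0 ->
    simple_null (mpeval Q a) (mpeuler Q a) x y ->
  condnum Q a x = (mpnorm Q (cabs a) * norm2 y^T * norm2 x
    / cabs ((y *m mpeuler Q a *m x) 0 0))%:E.
Proof.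
move=> a_neq0 sQx; have [x_neq0 y_neq0] := simple_null_neq0 sQx.
have [_ _ _ yEx] := sQx.
have [r0 [K1 [r0_gt0 K1_ge0 upper]]] := perturbation_upper a_neq0 sQx.
have [K2 K2_ge0 lower] := perturbation_lower a_neq0 sQx.
have al_gt0 : 0 < cabs a by rewrite cabs_gt0.
have Nx_gt0 : 0 < norm2 x by rewrite norm2_gt0.
have Ny_gt0 : 0 < norm2 y^T by rewrite norm2_gt0 -trmx0 (inj_eq trmx_inj).
have b_gt0 : 0 < cabs ((y *m mpeuler Q a *m x) 0 0) by rewrite cabs_gt0.
move: (cabs _) b_gt0 upper lower => b b_gt0 upper lower.
have sg_gt0 := mpnorm_gt0 a_neq0 sQx.
move: (cabs a) al_gt0 sg_gt0 upper lower => al al_gt0 sg_gt0 upper lower.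
move: (norm2 x) Nx_gt0 upper lower => Nx Nx_gt0 upper lower.
move: (norm2 y^T) Ny_gt0 upper lower => Ny Ny_gt0 upper lower.
set ka := _ / b.
have ka_gt0 : 0 < ka by rewrite divr_gt0 ?mulr_gt0.
have lin (c : R) : c * e @[e --> 0^'+] --> 0.
  rewrite -[X in _ --> X](mulr0 c); apply: cvgM; first exact: cvg_cst.
  exact: (cvg_at_right_filter cvg_id).
have inner (r eta : R) : 0 < r <= r0 -> 0 < eta ->
    \forall eps \near 0^'+,
    ((ka - eta)%:E
     <= ereal_sup [set t%:E | t in perturbation_ratios Q a x r eps]
     <= (ka + eta)%:E)%E.
  move=> r_bd eta_gt0; have /andP[r_gt0 r_le] := r_bd.
  have up : \forall eps \near 0^'+, (ereal_sup
      [set t%:E | t in perturbation_ratios Q a x r eps] <= (ka + eta)%:E)%E.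
    have Fcvg : (K1 * e + Ny * mpnorm Q (al + K1 * e) * (Nx + K1 * e))
        / (b - K1 * e) @[e --> 0^'+] --> ka.
      have -> : ka = (0 + Ny * mpnorm Q (al + 0) * (Nx + 0)) / (b - 0).
        by rewrite /ka !addr0 subr0 add0r [Ny * _]mulrC.
      apply: cvgM.
        apply: cvgD; first exact: lin.
        apply: cvgM; last by apply: cvgD; [apply: cvg_cst | apply: lin].
        apply: cvgM; first exact: cvg_cst.
        by apply: cvg_mpnorm; apply: cvgD; [apply: cvg_cst | apply: lin].
      apply: cvgV; first by rewrite subr0 gt_eqF.
      by apply: cvgB; [apply: cvg_cst | apply: lin].
    have F_le : \forall eps \near 0^'+,
        (K1 * eps + Ny * mpnorm Q (al + K1 * eps) * (Nx + K1 * eps))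
        / (b - K1 * eps) <= ka + eta by apply: (cvgr_le _ Fcvg); rewrite ltrDl.
    near=> eps; apply: ge_ereal_sup => _ [tau tauP <-]; rewrite lee_fin.
    apply: le_trans (_ : (K1 * eps + Ny * mpnorm Q (al + K1 * eps)
      * (Nx + K1 * eps)) / (b - K1 * eps) <= _); last by near: eps.
    have Kb : K1 * eps < b by near: eps; apply: (cvgr_lt _ (lin K1)).
    rewrite ler_pdivlMr ?subr_gt0 //; apply: upper r_bd _ _ tauP.
      by near: eps; apply: nbhs_right_gt.
    by near: eps; apply: (cvgr_le _ (lin K1)).
  have lo : \forall eps \near 0^'+, ((ka - eta)%:E <= ereal_sup
      [set t%:E | t in perturbation_ratios Q a x r eps])%E.
    (* A ratio of moduli is nonnegative; if [ka - eta] is negative, the ratio 0 suffices. *)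
    pose th := Num.max 0 (ka - eta).
    have th_ge0 : 0 <= th by rewrite le_max lexx.
    have th_lt : th < ka by rewrite gt_max ka_gt0 ltrBlDr ltrDl.
    pose s e := e * al * th.
    have s_cvg : s e @[e --> 0^'+] --> 0.
      by under eq_cvg do rewrite /s -mulrA mulrC; apply: lin.
    have Ks_cvg c : c * s e @[e --> 0^'+] --> 0.
      by rewrite -[X in _ --> X](mulr0 c); apply: cvgM => //; apply: cvg_cst.
    have sg_cvg : mpnorm Q (al - s e) @[e --> 0^'+] --> mpnorm Q al.
      rewrite -[X in _ --> mpnorm Q X](subr0 al); apply: cvg_mpnorm.
      by apply: cvgB => //; apply: cvg_cst.
    have main_cvg : mpnorm Q (al - s e) * (Nx - K2 * s e)
          - (th * b / Ny + K2 * th * s e)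
        @[e --> 0^'+] --> mpnorm Q al * (Nx - 0) - (th * b / Ny + 0).
      apply: cvgB; last by apply: cvgD => //; apply: cvg_cst.
      by apply: cvgM => //; apply: cvgB => //; apply: cvg_cst.
    have main_gt : 0 < mpnorm Q al * (Nx - 0) - (th * b / Ny + 0).
      rewrite subr0 addr0 subr_gt0 ltr_pdivrMr // -ltr_pdivlMr //.
      by rewrite [_ * Nx * Ny]mulrAC.
    near=> eps; apply: (@le_trans _ _ th%:E).
      by rewrite lee_fin le_max lexx orbT.
    apply: ereal_sup_ubound; exists th => //; apply: lower => //.
    - by near: eps; apply: (cvgr_le _ s_cvg).
    - by near: eps; apply: (cvgr_le _ (Ks_cvg K2)).
    - by near: eps; apply: (cvgr_le _ s_cvg).
    - by near: eps; apply: (cvgr_lt _ s_cvg).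
    - by near: eps; apply: (cvgr_lt _ (Ks_cvg K2)).
    - by near: eps; apply: (cvgr_gt _ sg_cvg).
    rewrite -subr_ge0; near: eps; exact: (cvgr_ge _ main_cvg).
  by near=> eps; apply/andP; split; near: eps.
have cvg_inner (r : R) : 0 < r <= r0 ->
    ereal_sup [set t%:E | t in perturbation_ratios Q a x r eps]
      @[eps --> 0^'+] --> ka%:E.
  move=> r_bd; apply/fine_cvgP; split.
    have := inner r 1 r_bd ltr01; apply: filterS => eps /andP[lo up].
    apply/fin_real; rewrite (lt_le_trans _ lo) ?ltNyr //.
    by rewrite (le_lt_trans up) ?ltry.
  apply/cvgrPdist_le => eta eta_gt0.
  have := inner r eta r_bd eta_gt0; apply: filterS => eps /=.
  case: (ereal_sup _) => [v| |]; rewrite ?leNye ?leye_eq ?andbF //= ?lee_fin.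
  by rewrite ler_distlC andbC.
rewrite /condnum; apply: cvg_lim => //; apply: cvg_near_cst.
near=> r; apply: cvg_lim => //; apply: cvg_inner; apply/andP; split.
  by near: r; apply: nbhs_right_gt.
by near: r; apply: nbhs_right_le.
Unshelve. all: by end_near.
Qed.
End Perturbation.

(** * Block structure of [TP A] *)

Section BlockNorms.
Variables (R : realType) (k n : nat).
Implicit Types (z : 'cV[R[i]]_(\sum_(a < k) n)).
Implicit Types (B : 'I_k -> 'I_k -> 'M[R[i]]_n).

Lemma submxcolZ (c : R[i]) z a : submxcol (c *: z) a = c *: submxcol z a.
Proof. by apply/matrixP => i j; rewrite !mxE. Qed.

Lemma sqr_norm2_blocks z :
  norm2 z ^+ 2 = \sum_a norm2 (submxcol z a) ^+ 2.
Proof.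
apply: (@complexI R); rewrite -mulmx_tr_conj -{1 2}(submxcolK z).
rewrite tr_mxcol.
have -> : map_mx (@conjc R) (\mxcol_a submxcol z a)
    = \mxcol_a map_mx (@conjc R) (submxcol z a).
  by apply/matrixP => i j; rewrite !mxE.
rewrite mul_mxrow_mxcol summxE rmorph_sum; apply: eq_bigr => a _.
by rewrite mulmx_tr_conj.
Qed.

Lemma ler_norm2_block z a : norm2 (submxcol z a) <= norm2 z.
Proof.
rewrite -(ler_pXn2r (_ : 0 < 2)%N) ?nnegrE ?norm2_ge0 // sqr_norm2_blocks.
by rewrite (bigD1 a) //= lerDl sumr_ge0 // => *; rewrite exprn_ge0 ?norm2_ge0.
Qed.

Lemma submxcol_mxblock B z a :
  submxcol (\mxblock_(a, b) B a b *m z) a = \sum_b B a b *m submxcol z b.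
Proof. by rewrite -{1}(submxcolK z) mul_mxblock_mxrow mxcolK. Qed.

(** A vector supported on block [b] keeps its norm, and block [a] of its image is [B a b *m u]. *)
Lemma specnorm_block B a b :
  specnorm (B a b) <= specnorm (\mxblock_(a, b) B a b).
Proof.
apply: specnorm_le => [|u]; first exact: specnorm_ge0.
pose z := \mxcol_(c < k) if c == b then u else 0.
have zc c : submxcol z c = if c == b then u else 0 by rewrite mxcolK.
have -> : B a b *m u = submxcol (\mxblock_(a, b) B a b *m z) a.
  rewrite submxcol_mxblock (bigD1 b) //= big1 ?addr0 ?zc ?eqxx // => c cb.
  by rewrite zc (negPf cb) mulmx0.
have <- : norm2 z = norm2 u.
  apply/eqP; rewrite -(eqrXn2 (_ : 0 < 2)%N) ?norm2_ge0 // sqr_norm2_blocks.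
  rewrite (bigD1 b) //= zc eqxx big1 ?addr0 // => c cb.
  by rewrite zc (negPf cb) norm20 expr0n.
exact: (le_trans (ler_norm2_block _ _)) (norm2_mulmx _ _).
Qed.

(** Shape of a block row in either coefficient of [TP A]: a diagonal block and at most one scalar
    block. The test [c != a] discards the latter in a row that is its own partner. *)
Lemma sum_two_blocks (D : 'M[R[i]]_n) (e : R[i]) (a c : 'I_k)
    (zb : 'I_k -> 'cV[R[i]]_n) :
  \sum_b ((if b == a then D else 0)
          + (if (b == c) && (c != a) then e%:M else 0)) *m zb b
    = D *m zb a + (if c != a then e *: zb c else 0).
Proof.
under eq_bigr do rewrite mulmxDl.
rewrite big_split /=; congr (_ + _).
  rewrite (bigD1 a) //= eqxx big1 ?addr0 // => b /negPf ->.
  by rewrite mul0mx.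
rewrite (bigD1 c) //= eqxx /= big1 ?addr0 => [|b /negPf ->]; last first.
  by rewrite mul0mx.
by case: ifP => _; rewrite ?mul0mx // mul_scalar_mx.
Qed.
End BlockNorms.

Section Pencil.
Variables (R : realType) (n : nat) (L : matpoly R 1 n).

Let lift_ord0 : lift ord0 ord0 = ord_max :> 'I_2.
Proof. exact: val_inj. Qed.

Lemma mpeval_pencil (a : R[i]) : mpeval L a = L ord0 + a *: L ord_max.
Proof. by rewrite /mpeval big_ord_recl big_ord1 lift_ord0 scale1r. Qed.

Lemma mpeuler_pencil (a : R[i]) : mpeuler L a = a *: L ord_max.
Proof.
by rewrite /mpeuler big_ord_recl big_ord1 lift_ord0 mul0r scale0r add0r mul1r.
Qed.

Lemma mpnorm_pencil (s : R) :
  mpnorm L s = specnorm (L ord0) + s * specnorm (L ord_max).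
Proof. by rewrite /mpnorm big_ord_recl big_ord1 lift_ord0 mul1r. Qed.
End Pencil.

(** * Action of the coefficients of the pencil on block vectors *)

Section TP.
Variables (R : realType) (m n : nat).
Local Notation k := (m.*2.+1).
Implicit Types (A : matpoly R k n) (z : 'cV[R[i]]_(\sum_(a < k) n)).

(* The column of the only nonzero off-diagonal block in row [a] of the
   coefficient of [lambda] ([partner1]), resp. of the constant coefficient
   ([partner0]); a row without such a block is its own partner. *)
Definition partner1 (a : 'I_k) : 'I_k := inord (if odd a then a.+1 else a.-1).
Definition partner0 (a : 'I_k) : 'I_k :=
  inord (if odd a then a.-1 else if (a < m.*2)%N then a.+1 else a).

Lemma partner1E (a : 'I_k) :
  partner1 a = (if odd a then a.+1 else a.-1) :> nat.
Proof. by rewrite inordK //; case: a => a /=; case: ifP => /=; lia. Qed.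

Lemma partner0E (a : 'I_k) : partner0 a =
  (if odd a then a.-1 else if (a < m.*2)%N then a.+1 else a) :> nat.
Proof. by rewrite inordK //; case: a => a /=; do 2?case: ifP => /=; lia. Qed.

Lemma partner1K : involutive partner1.
Proof.
move=> a; apply: val_inj; rewrite /= !partner1E.
by case: a => a /=; case: ifP => /=; case: ifP => /=; lia.
Qed.

Lemma partner0K : involutive partner0.
Proof.
move=> a; apply: val_inj; rewrite /= !partner0E.
by case: a => a /=; do 4?case: ifP => /=; lia.
Qed.

Lemma TP_block1E A (a b : 'I_k) : TP_block A a.+1 b.+1 ord_max
  = (if b == a then if odd a then 0 else A (inord (k - a)) else 0)
    + (if (b == partner1 a) && (partner1 a != a) then 1%:M else 0).
Proof.
rewrite -!val_eqE /= partner1E /TP_block !eqSS /linear_coefs !subSS /=.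
case: a b => a alt [b blt] /=; have [<-|ab] := eqVneq a b.
  by rewrite [a == _]eq_sym andbN addr0; case: (odd a).
rewrite add0r.
case: ifP => [adj|nadj]; last by rewrite ifF //=; move: nadj; case: ifP; lia.
by case: ifP => od; [rewrite ifF | rewrite ifT] => //=;
   move: adj od; case: ifP; lia.
Qed.

Lemma TP_block0E A (a b : 'I_k) : TP_block A a.+1 b.+1 ord0
  = (if b == a then if odd a then 0 else A (inord (m.*2 - a)) else 0)
    + (if (b == partner0 a) && (partner0 a != a) then (- 1)%:M else 0).
Proof.
rewrite -!val_eqE /= partner0E /TP_block !eqSS /linear_coefs !subSS /=.
case: a b => a alt [b blt] /=; have [<-|ab] := eqVneq a b.
  by rewrite [a == _]eq_sym andbN addr0; case: (odd a).
rewrite add0r.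
case: ifP => [adj|nadj].
  by case: ifP => od; [rewrite ifT ?raddfN | rewrite ifF] => //=;
     move: adj od; do 2?case: ifP; lia.
by rewrite ifF //=; move: nadj; do 2?case: ifP; lia.
Qed.

Lemma TP_row1 A z (a : 'I_k) : submxcol (TP A ord_max *m z) a
  = (if odd a then 0 else A (inord (k - a))) *m submxcol z a
    + (if partner1 a != a then submxcol z (partner1 a) else 0).
Proof.
rewrite submxcol_mxblock (eq_bigr _ (fun b _ => congr1 (mulmx^~ _)
  (TP_block1E A a b))).
by rewrite sum_two_blocks scale1r.
Qed.

Lemma TP_row0 A z (a : 'I_k) : submxcol (TP A ord0 *m z) a
  = (if odd a then 0 else A (inord (m.*2 - a))) *m submxcol z a
    - (if partner0 a != a then submxcol z (partner0 a) else 0).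
Proof.
rewrite submxcol_mxblock (eq_bigr _ (fun b _ => congr1 (mulmx^~ _)
  (TP_block0E A a b))).
by rewrite sum_two_blocks; congr (_ + _); case: ifP; rewrite ?scaleN1r ?oppr0.
Qed.

Lemma TP_tr A (j : 'I_2) : (TP A j)^T = TP (fun i => (A i)^T) j.
Proof.
rewrite /TP tr_mxblock; apply: eq_mxblock => a b.
have E (L1 L0 : 'M[R[i]]_n) :
    (linear_coefs L1 L0 j)^T = linear_coefs L1^T L0^T j.
  by rewrite /linear_coefs; case: ifP.
rewrite /TP_block; have [<-|ab] := eqVneq b.+1 a.+1.
  by case: (odd _); rewrite E ?trmx0.
rewrite [X in if X then _ else _]orbC minnC.
case: (_ || _); last by rewrite E trmx0.
by case: (odd _); rewrite E ?linearN /= trmx0 trmx1.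
Qed.

Section SpecNorm.
Variables (A : matpoly R k n) (M : R).
Hypotheses (M_ge1 : 1 <= M) (A_le : forall i, specnorm (A i) <= M).

(** Since [1 <= M], the squared norm of each block row is at most [2 * M ^+ 2] times the sum of two
    squared block norms. As [p] is a bijection, the two resulting sums over the rows agree, for a
    total factor [4 * M ^+ 2]. *)
Lemma specnorm_rows (B : 'M[R[i]]_(\sum_(a < k) n)) (p : 'I_k -> 'I_k) :
    involutive p ->
    (forall z a, norm2 (submxcol (B *m z) a)
       <= M * norm2 (submxcol z a) + norm2 (submxcol z (p a))) ->
  specnorm B <= 2 * M.
Proof.
move=> pK row_le; have M_ge0 : 0 <= M := le_trans ler01 M_ge1.
apply: specnorm_le => [|z]; first by rewrite mulr_ge0.
rewrite -(ler_pXn2r (_ : 0 < 2)%N) ?nnegrE; nonneg.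
rewrite exprMn !sqr_norm2_blocks.
apply: (@le_trans _ _ (\sum_a (2 * M ^+ 2 * norm2 (submxcol z a) ^+ 2
    + 2 * M ^+ 2 * norm2 (submxcol z (p a)) ^+ 2))).
  apply: ler_sum => a _.
  apply: (@le_trans _ _ ((M * norm2 (submxcol z a)
      + M * norm2 (submxcol z (p a))) ^+ 2)).
    rewrite ler_pXn2r ?nnegrE //; nonneg.
    apply: (le_trans (row_le z a)); rewrite lerD2l ler_peMl //; nonneg.
  move: (norm2 _) (norm2 _) => s t.
  by have := sqr_ge0 (M * s - M * t); lra.
have e : \sum_a norm2 (submxcol z (p a)) ^+ 2
    = \sum_a norm2 (submxcol z a) ^+ 2.
  by rewrite [RHS](reindex_inj (inv_inj pK)).
by rewrite big_split /= -!mulr_sumr e; lra.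
Qed.

Lemma specnorm_TP (j : 'I_2) : specnorm (TP A j) <= 2 * M.
Proof.
have M_ge0 : 0 <= M := le_trans ler01 M_ge1.
have D_le (b : bool) i (u : 'cV_n) :
    norm2 ((if b then 0 else A i) *m u) <= M * norm2 u.
  case: b; first by rewrite mul0mx norm20; nonneg.
  by apply: (le_trans (norm2_mulmx _ _)); rewrite ler_wpM2r //; nonneg.
have off_le (b : bool) (u : 'cV[R[i]]_n) :
    norm2 (if b then u else 0) <= norm2 u.
  by case: b => //; rewrite norm20; nonneg.
case: j => -[|[|//]] j_lt.
  rewrite (_ : Ordinal _ = ord0); last exact: val_inj.
  apply: specnorm_rows partner0K _ => z a; rewrite TP_row0.
  by apply: (le_trans (ler_norm2D _ _)); rewrite norm2N lerD.
rewrite (_ : Ordinal _ = ord_max); last exact: val_inj.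
apply: specnorm_rows partner1K _ => z a; rewrite TP_row1.
by apply: (le_trans (ler_norm2D _ _)); rewrite lerD.
Qed.
End SpecNorm.

(* The blocks are numbered backwards, so that [even_block z i] is [delta ^+ i]
   times the last block when [z] is an eigenvector. *)
Definition even_block z i := submxcol z (inord (m - i).*2 : 'I_k).
(** Parity refers to indices counted from 0, so these are the even-numbered blocks counted from 1.
    The value 0 outside 1..m supplies the boundary conditions of the recurrence at both ends. *)
Definition odd_block z i : 'cV[R[i]]_n :=
  if (0 < i <= m)%N then submxcol z (inord (m - i).*2.+1 : 'I_k) else 0.

Lemma even_blockP z : (forall i, (i <= m)%N -> even_block z i = 0) ->
  (forall i, odd_block z i = 0) -> z = 0.
Proof.
move=> ze0 zo0; apply/mxcolP => a; rewrite submxcol0.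
have a_lt := ltn_ord a; case: (boolP (odd a)) => a_odd.
  have := zo0 (m - a./2)%N; rewrite /odd_block ifT; last by lia.
  by move=> <-; congr submxcol; apply: val_inj; rewrite /= inordK; lia.
rewrite -(ze0 (m - a./2)%N) ?leq_subr //.
by congr submxcol; apply: val_inj; rewrite /= inordK; lia.
Qed.

Lemma sum_parity (V : nmodType) (F : 'I_k -> V) : \sum_a F a
  = \sum_(i < m.+1) F (inord (m - i).*2)
    + \sum_(i < m) F (inord (m - i.+1).*2.+1).
Proof.
pose G i := F (inord i).
have -> : \sum_a F a = \sum_(a < k) G a.
  by apply: eq_bigr => a _; rewrite /G inord_val.
rewrite [X in _ = X + _](reindex_inj rev_ord_inj).
rewrite [X in _ = _ + X](reindex_inj rev_ord_inj) /=.
rewrite (eq_bigr (fun i : 'I_m.+1 => G i.*2)) => [|i _]; last first.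
  by rewrite subSS subKn // -ltnS.
rewrite [X in _ = _ + X](eq_bigr (fun i : 'I_m => G i.*2.+1)) => [|i _].
  elim: m => [|p IHp]; first by rewrite !big_ord_recr !big_ord0 /= addr0.
  rewrite doubleS big_ord_recr big_ord_recr IHp /= [in RHS]big_ord_recr /=.
  rewrite [X in _ = _ + X]big_ord_recr /=.
  by rewrite [RHS]addrAC -!addrA.
by rewrite subnSK // subKn // ltnW.
Qed.

Lemma sqr_norm2_parity z : norm2 z ^+ 2
  = \sum_(i < m.+1) norm2 (even_block z i) ^+ 2
    + \sum_(i < m) norm2 (odd_block z i.+1) ^+ 2.
Proof.
rewrite sqr_norm2_blocks sum_parity; congr (_ + _).
by apply: eq_bigr => i _; rewrite /odd_block ltn_ord.
Qed.

Lemma mulmx_tr_parity (w z : 'cV[R[i]]_(\sum_(a < k) n)) : w^T *m z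
  = \sum_(i < m.+1) (even_block w i)^T *m even_block z i
    + \sum_(i < m) (odd_block w i.+1)^T *m odd_block z i.+1.
Proof.
rewrite -(submxcolK w) -(submxcolK z) tr_mxcol mul_mxrow_mxcol sum_parity.
rewrite !submxcolK; congr (_ + _).
by apply: eq_bigr => i _; rewrite /odd_block ltn_ord.
Qed.

Lemma even_block_TP1 A z i : (i <= m)%N -> even_block (TP A ord_max *m z) i
  = A (inord i.*2.+1) *m even_block z i + odd_block z i.+1.
Proof.
move=> i_le; have lt : ((m - i).*2 < k)%N by lia.
rewrite /even_block TP_row1 -val_eqE /= partner1E !inordK // odd_double.
congr (A (inord _) *m _ + _); first by lia.
rewrite /odd_block; case: ifP => h1; case: ifP => h2 //; try by lia.
congr submxcol; apply: val_inj; rewrite /= partner1E !inordK ?odd_double; lia.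
Qed.

Lemma odd_block_TP1 A z i : (i < m)%N ->
  odd_block (TP A ord_max *m z) i.+1 = even_block z i.
Proof.
move=> i_lt; have lt : ((m - i.+1).*2.+1 < k)%N by lia.
rewrite /odd_block ifT; last by lia.
rewrite TP_row1 -val_eqE /= partner1E !inordK //= odd_double /= mul0mx add0r.
rewrite ifT; last by lia.
congr submxcol; apply: val_inj.
rewrite /= partner1E !inordK //=; do ?case: ifP; lia.
Qed.

Lemma even_block_TP0 A z i : (i <= m)%N -> even_block (TP A ord0 *m z) i
  = A (inord i.*2) *m even_block z i - odd_block z i.
Proof.
move=> i_le; have lt : ((m - i).*2 < k)%N by lia.
rewrite /even_block TP_row0 -val_eqE /= partner0E !inordK // odd_double.
congr (A (inord _) *m _ - _); first by lia.
rewrite /odd_block; case: ifP => h1; case: ifP => h2 //;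
  try by move: h1 h2; case: ifP; lia.
congr submxcol; apply: val_inj; rewrite /= partner0E !inordK ?odd_double //=.
  by rewrite ifT; lia.
by lia.
Qed.

Lemma odd_block_TP0 A z i : (i < m)%N ->
  odd_block (TP A ord0 *m z) i.+1 = - even_block z i.+1.
Proof.
move=> i_lt; have lt : ((m - i.+1).*2.+1 < k)%N by lia.
rewrite /odd_block ifT; last by lia.
rewrite TP_row0 -val_eqE /= partner0E !inordK //= odd_double /= mul0mx add0r.
rewrite ifT; last by lia.
congr (- _); congr submxcol; apply: val_inj.
rewrite /= partner0E !inordK //=; do ?case: ifP; lia.
Qed.

Lemma mpeval_TP_tr A (a : R[i]) :
  (mpeval (TP A) a)^T = mpeval (TP (fun i => (A i)^T)) a.
Proof. by rewrite !mpeval_pencil linearD linearZ /= !TP_tr. Qed.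

Section Kernel.
Variables (A : matpoly R k n) (a : R[i]) (z : 'cV[R[i]]_(\sum_(c < k) n)).
Hypotheses (Tz : mpeval (TP A) a *m z = 0).

(** An odd block row of the pencil couples only two consecutive even blocks, with coefficients [a]
    and -1. *)
Lemma TP_kernel_even i : (i <= m)%N ->
  even_block z i = a ^+ i *: even_block z 0.
Proof.
elim: i => [|i IHi] i_lt; first by rewrite scale1r.
have : odd_block (mpeval (TP A) a *m z) i.+1 = 0.
  by rewrite Tz /odd_block submxcol0; case: ifP.
rewrite mpeval_pencil mulmxDl -scalemxAl /odd_block ifT; last by lia.
rewrite submxcolD; have := odd_block_TP0 A z i_lt.
rewrite {1}/odd_block ifT; last by lia.
move=> ->; have := odd_block_TP1 A z i_lt.
rewrite submxcolZ {1}/odd_block ifT; last by lia.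
move=> -> /eqP; rewrite addrC subr_eq0 => /eqP <-.
by rewrite IHi 1?ltnW // scalerA exprS.
Qed.

Lemma TP_kernel_odd i : (i <= m)%N -> odd_block z i
  = (A (inord i.*2) + a *: A (inord i.*2.+1)) *m even_block z i
    + a *: odd_block z i.+1.
Proof.
move=> i_le; have : even_block (mpeval (TP A) a *m z) i = 0.
  by rewrite Tz /even_block submxcol0.
rewrite mpeval_pencil mulmxDl -scalemxAl /even_block submxcolD.
rewrite submxcolZ -!/(even_block _ _) even_block_TP0 // even_block_TP1 //.
rewrite scalerDr addrAC => /eqP; rewrite subr_eq add0r => /eqP <-.
by rewrite mulmxDl -scalemxAl addrA.
Qed.
End Kernel.
End TP.

(** * Null vectors of the pencil: tails of the polynomial, growth, pairing *)

Section TPKernel.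
Variables (R : realType) (m n : nat).
Local Notation k := (m.*2.+1).

Section Kernel.
Variables (A : matpoly R k n) (a : R[i]) (z : 'cV[R[i]]_(\sum_(c < k) n)).
Hypotheses (Tz : mpeval (TP A) a *m z = 0).

(** Downward induction from i = m + 1, where the sum is empty; as in Horner's scheme, each step
    prepends the terms of degrees 2i and 2i + 1. At i = 0 the left side vanishes and the sum is the
    whole of P(a), so the last block is a null vector of P(a). *)
Lemma TP_kernel_odd_sum i : (i <= m.+1)%N -> a ^+ i *: odd_block z i
  = (\sum_(i.*2 <= s < m.+1.*2) a ^+ s *: A (inord s)) *m even_block z 0.
Proof.
move=> i_le; rewrite -(subKn i_le); move: (m.+1 - i)%N (leq_subr i m.+1).
elim=> [|j IHj] j_le.
  by rewrite subn0 big_geq // mul0mx /odd_block ltnn andbF scaler0.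
have le_m : (m.+1 - j.+1 <= m)%N by lia.
rewrite (TP_kernel_odd Tz) // scalerDr scalerA -exprSr.
have -> : (m.+1 - j.+1).+1 = (m.+1 - j)%N by lia.
rewrite [X in _ + X](IHj (ltnW j_le)) (TP_kernel_even Tz) //.
rewrite -scalemxAr scalerA.
have -> : (m.+1 - j).*2 = (m.+1 - j.+1).*2.+2 by lia.
set i' := (m.+1 - j.+1)%N; have lt1 : (i'.*2 < m.+1.*2)%N by lia.
have lt2 : (i'.*2.+1 < m.+1.*2)%N by lia.
rewrite (big_ltn lt1) (big_ltn lt2) addrA [RHS]mulmxDl; congr (_ + _).
by rewrite scalemxAl scalerDr scalerA -exprD addnn -exprSr.
Qed.

Lemma TP_kernel_last : mpeval A a *m even_block z 0 = 0.
Proof.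
have := TP_kernel_odd_sum (leq0n m.+1).
rewrite /odd_block ltnn scaler0 => ->; rewrite doubleS big_mkord.
by congr (_ *m _); apply: eq_bigr => i _; rewrite inord_val.
Qed.

(** Applied to differences, this makes the null space of the pencil a line as soon as that of [A] is
    one. *)
Lemma TP_kernel_eq0 : a != 0 -> even_block z 0 = 0 -> z = 0.
Proof.
move=> a_neq0 u0; apply: even_blockP => [i i_le|i].
  by rewrite (TP_kernel_even Tz) // u0 scaler0.
have [i_le|i_gt] := leqP i m.+1; last first.
  by rewrite /odd_block ifF //; lia.
have /eqP := TP_kernel_odd_sum i_le.
by rewrite u0 mulmx0 scaler_eq0 expf_eq0 (negPf a_neq0) andbF => /eqP.
Qed.

Section KernelNorm.
Variable M : R.
Hypothesis A_le : forall i, specnorm (A i) <= M.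

Lemma TP_kernel_coef_le i : (i <= m)%N ->
  norm2 ((A (inord i.*2) + a *: A (inord i.*2.+1)) *m even_block z i)
    <= (1 + cabs a) * M * (cabs a ^+ i * norm2 (even_block z 0)).
Proof.
move=> i_le; rewrite (TP_kernel_even Tz) // -cabsX -norm2Z; set u := _ *: _.
rewrite mulmxDl -scalemxAl; apply: (le_trans (ler_norm2D _ _)).
rewrite norm2Z !mulrDl mul1r; apply: lerD.
  by apply: (le_trans (norm2_mulmx _ _)); rewrite ler_wpM2r //; nonneg.
rewrite -[leRHS]mulrA ler_wpM2l ?cabs_ge0 //.
by apply: (le_trans (norm2_mulmx _ _)); rewrite ler_wpM2r //; nonneg.
Qed.

(** Solved downwards from [odd_block z m.+1 = 0], the recurrence multiplies by [a], which does not
    expand; each of the m + 1 - i steps contributes at most [2 * M], relative to the power of |a| on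
    the right. *)
Lemma TP_kernel_odd_le1 i : cabs a <= 1 -> (i <= m.+1)%N ->
  norm2 (odd_block z i)
    <= 2 * (m.+1 - i)%:R * M * (cabs a ^+ i * norm2 (even_block z 0)).
Proof.
move=> a_le1 i_le; have M_ge0 := le_trans (specnorm_ge0 _) (A_le ord0).
rewrite -{1 3}(subKn i_le); move: (m.+1 - i)%N (leq_subr i m.+1).
elim=> [|j IHj] j_le.
  by rewrite subn0 /odd_block ltnn andbF norm20 mulr0 !mul0r.
have le_m : (m.+1 - j.+1 <= m)%N by lia.
rewrite (TP_kernel_odd Tz) //; apply: (le_trans (ler_norm2D _ _)).
have h1 := TP_kernel_coef_le le_m.
have := IHj (ltnW j_le); have -> : (m.+1 - j)%N = (m.+1 - j.+1).+1 by lia.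
rewrite norm2Z exprS; move: h1; set i' := (m.+1 - j.+1)%N.
rewrite -[j.+1%:R]natr1; have := cabs_ge0 a.
have : 0 <= cabs a ^+ i' * norm2 (even_block z 0) by nonneg.
rewrite -[_ * _ * norm2 (even_block z 0)]mulrA.
move: (_ * norm2 (even_block z 0)) => p.
move: (norm2 _) (norm2 _) => t s p_ge0; move: (cabs a) a_le1 => d d_le1 d_ge0.
move=> s_le t_le.
have h2 : d * t <= d * (2 * j%:R * M * (d * p)) by rewrite ler_wpM2l.
have h3 : 2 * j%:R * M * p * (d * d) <= 2 * j%:R * M * p * 1.
  by rewrite ler_wpM2l ?mulr_ile1 //; nonneg.
have h4 : M * p * d <= M * p * 1 by rewrite ler_wpM2l //; nonneg.
lra.
Qed.

(** Solved upwards from [odd_block z 0 = 0], the recurrence divides by [a]. The factor [cabs a] on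
    the left records the gain 1/|a| on which the refined upper bound depends. *)
Lemma TP_kernel_odd_ge1 i : 1 <= cabs a -> (i <= m)%N ->
  cabs a * norm2 (odd_block z i)
    <= 2 * i%:R * M * (cabs a ^+ i * norm2 (even_block z 0)).
Proof.
move=> a_ge1; have M_ge0 := le_trans (specnorm_ge0 _) (A_le ord0).
elim: i => [|i IHi] i_lt.
  by rewrite /odd_block ltnn norm20 !mulr0 !mul0r.
have := TP_kernel_odd Tz (ltnW i_lt) => /eqP.
rewrite addrC -subr_eq => /eqP/(congr1 (@norm2 R n)); rewrite norm2Z => <-.
apply: (le_trans (ler_norm2D _ _)); rewrite norm2N.
have := TP_kernel_coef_le (ltnW i_lt); have := IHi (ltnW i_lt).
have : 0 <= cabs a ^+ i * norm2 (even_block z 0) by nonneg.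
have := norm2_ge0 (odd_block z i).
rewrite exprS -[_ * _ * norm2 (even_block z 0)]mulrA -[i.+1%:R]natr1.
move: (_ * norm2 (even_block z 0)) => p.
move: (norm2 _) (norm2 _) => t s s_ge0 p_ge0; move: (cabs a) a_ge1 => d d_ge1.
have d_ge0 : 0 <= d := le_trans ler01 d_ge1.
move=> s_le t_le.
have h1 : s * 1 <= s * d by rewrite ler_wpM2l.
have h2 : M * p * 1 <= M * p * d by rewrite ler_wpM2l //; nonneg.
have h3 : 2 * i%:R * M * p * 1 <= 2 * i%:R * M * p * d.
  by rewrite ler_wpM2l //; nonneg.
lra.
Qed.
End KernelNorm.
End Kernel.

(** The term [c s] is counted s times: twice for each of the [s./2] tails containing it, and once
    more when s is odd. *)
Lemma sum_tails (V : nmodType) (c : nat -> V) p :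
  \sum_(i < p.+1) c i.*2.+1
    + (\sum_(i < p) \sum_(i.+1.*2 <= s < p.+1.*2) c s) *+ 2
  = \sum_(0 <= s < p.+1.*2) c s *+ s.
Proof.
elim: p => [|p IHp].
  by rewrite big_ord1 big_ord0 mul0rn addr0 big_ltn // big_nat1 mulr0n add0r.
rewrite [in RHS]doubleS 2?big_nat_recr //= -{}IHp big_ord_recr /=.
rewrite [X in _ + X *+ 2](eq_bigr (fun i : 'I_p.+1 =>
  \sum_(i.+1.*2 <= s < p.+1.*2) c s
  + (c p.+1.*2 + c p.+1.*2.+1))) => [|i _]; last first.
  have lt : (i.+1.*2 <= p.+1.*2)%N by rewrite leq_double.
  rewrite [p.+2.*2]doubleS big_nat_recr ?(leqW lt) //=.
  by rewrite big_nat_recr //= addrA.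
rewrite big_split /= sumr_const card_ord.
rewrite [X in _ + (X + _) *+ 2]big_ord_recr /= big_geq // addr0.
have rearrange (v t e o : V) q : v + o + (t + (e + o) *+ q) *+ 2
    = v + t *+ 2 + e *+ q.*2 + o *+ q.*2.+1.
  rewrite !mulrnDl -(mulrnA e) -(mulrnA o) muln2 (mulrSr o) !addrA.
  by rewrite -!addrA; congr (_ + _); rewrite addrC -!addrA.
exact: rearrange.
Qed.

(** In the leading coefficient, the diagonal blocks yield the odd-degree terms, while the identity
    blocks yield each tail of P twice, once through the odd blocks of [z] and once through those of
    [w]. By [sum_tails] the degree s then receives the weight s that it has in [mpeuler]. *)
Lemma TP_kernel_pairing (A : matpoly R k n) (a : R[i])
    (w z : 'cV[R[i]]_(\sum_(c < k) n)) :
    mpeval (TP (fun i => (A i)^T)) a *m w = 0 -> mpeval (TP A) a *m z = 0 ->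
  w^T *m mpeuler (TP A) a *m z
    = (even_block w 0)^T *m mpeuler A a *m even_block z 0.
Proof.
move=> Tw Tz; set v := even_block w 0; set u := even_block z 0.
pose c s := a ^+ s *: (v^T *m A (inord s) *m u).
rewrite mpeuler_pencil -scalemxAr -scalemxAl -(mulmxA w^T) mulmx_tr_parity.
have -> : v^T *m mpeuler A a *m u = \sum_(0 <= s < m.+1.*2) c s *+ s.
  rewrite /mpeuler mulmx_sumr mulmx_suml doubleS big_mkord.
  apply: eq_bigr => i _; rewrite /c inord_val -scalemxAr -scalemxAl.
  by rewrite -scaler_nat scalerA.
rewrite -sum_tails scalerDr.
rewrite (eq_bigr (fun i : 'I_m.+1 => (even_block w i)^T *m A (inord i.*2.+1)
  *m even_block z i + (even_block w i)^T *m odd_block z i.+1)) => [|i _].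
  rewrite big_split /= scalerDr -addrA; congr (_ + _).
    rewrite scaler_sumr; apply: eq_bigr => i _.
    have i_le : (i <= m)%N by rewrite -ltnS.
    rewrite [even_block w i](TP_kernel_even Tw i_le).
    rewrite [even_block z i](TP_kernel_even Tz i_le).
    rewrite -scalemxAr [X in X *m _ *m _]linearZ /= -!scalemxAl !scalerA.
    by rewrite -exprD addnn -exprS.
  rewrite big_ord_recr /= [odd_block z m.+1]/odd_block ltnn andbF mulmx0 addr0.
  rewrite mulr2n !scaler_sumr; congr (_ + _); apply: eq_bigr => i _.
    rewrite [even_block w i](TP_kernel_even Tw (ltnW (ltn_ord i))).
    rewrite [X in X *m _]linearZ /= -scalemxAl scalerA -exprS scalemxAr.
    rewrite (TP_kernel_odd_sum Tz (leqW (ltn_ord i))).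
    rewrite mulmxA mulmx_sumr mulmx_suml; apply: eq_bigr => s _.
    by rewrite /c -scalemxAr -scalemxAl.
  rewrite odd_block_TP1 // (TP_kernel_even Tz (ltnW (ltn_ord i))).
  rewrite -scalemxAr scalerA -exprS scalemxAl.
  have -> : a ^+ i.+1 *: (odd_block w i.+1)^T
      = (a ^+ i.+1 *: odd_block w i.+1)^T.
    by rewrite linearZ.
  rewrite (TP_kernel_odd_sum Tw (leqW (ltn_ord i))) -/v -/u trmx_mul.
  rewrite linear_sum mulmx_sumr mulmx_suml.
  by apply: eq_bigr => s _; rewrite linearZ /= trmxK /c -scalemxAr -scalemxAl.
by rewrite even_block_TP1 ?mulmxDr ?mulmxA // -ltnS.
Qed.
End TPKernel.

(** * Comparison of the condition numbers *)

Section Ratio.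
Variables (R : realType) (m n : nat).
Local Notation k := (m.*2.+1).
Implicit Types (A : matpoly R k n) (a : R[i]) (z : 'cV[R[i]]_(\sum_(c < k) n)).

Lemma mpeval_tr A a : (mpeval A a)^T = mpeval (fun i => (A i)^T) a.
Proof.
by rewrite /mpeval linear_sum; apply: eq_bigr => i _; rewrite linearZ.
Qed.

(** The left vector used for [A] is [v^T], cut out of [w], so that the pairings in the two condition
    numbers differ only by the factor [c] with [u = c *: x], which rescaling [x] to [u] removes. *)
Lemma condnum_ratio A a (x : 'cV_n) z : mpregular A -> a != 0 ->
    simple_eigenvalue A a -> right_eigenvector A a x ->
    right_eigenvector (TP A) a z ->
  exists w : 'cV_(\sum_(c < k) n),
    [/\ mpeval (TP (fun i => (A i)^T)) a *m w = 0,
    even_block w 0 != 0, even_block z 0 != 0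
    & (condnum (TP A) a z / condnum A a x)%E =
      (mpnorm (TP A) (cabs a) * (norm2 w * norm2 z)
       / (mpnorm A (cabs a)
          * (norm2 (even_block w 0) * norm2 (even_block z 0))))%:E].
Proof.
move=> regA a_neq0 simpleA x_eig [z_neq0 Tz].
have [y sAxy] := simple_eigenvalue_null regA a_neq0 simpleA x_eig.
have [x_neq0 y_neq0] := simple_null_neq0 sAxy.
have [Ax yA kerA yEx] := sAxy.
set u := even_block z 0; have Au : mpeval A a *m u = 0 := TP_kernel_last Tz.
have u_neq0 : u != 0.
  by apply: contra z_neq0 => /eqP u0; apply/eqP/(TP_kernel_eq0 Tz).
have [c uc] := kerA u Au.
have c_neq0 : c != 0 by apply: contraNneq u_neq0 => c0; rewrite uc c0 scale0r.
have [wt wt_neq0 wtT] : exists2 wt : 'rV_(\sum_(c < k) n),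
    wt != 0 & wt *m mpeval (TP A) a = 0.
  apply/det0P; rewrite -det_tr; apply/det0P; exists z^T.
    by rewrite -trmx0 (inj_eq trmx_inj).
  by rewrite -trmx_mul Tz trmx0.
pose w := wt^T.
have w_neq0 : w != 0 by rewrite -trmx0 (inj_eq trmx_inj).
have Tw : mpeval (TP (fun i => (A i)^T)) a *m w = 0.
  by rewrite -mpeval_TP_tr -trmx_mul wtT trmx0.
exists w; set v := even_block w 0.
have v_neq0 : v != 0.
  by apply: contra w_neq0 => /eqP v0; apply/eqP/(TP_kernel_eq0 Tw).
have vA : v^T *m mpeval A a = 0.
  rewrite -(trmxK (mpeval A a)) -trmx_mul mpeval_tr.
  by rewrite (TP_kernel_last Tw) trmx0.
have [g vg] := corank1_left (simple_null_rank sAxy) y_neq0 yA vA.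
have {}vg : v^T = g 0 0 *: y by rewrite -mul_scalar_mx -mx11_scalar.
have g_neq0 : g 0 0 != 0.
  apply: contraNneq v_neq0 => g0.
  by rewrite -(inj_eq trmx_inj) vg g0 scale0r trmx0.
have vEx : (v^T *m mpeuler A a *m x) 0 0 != 0.
  by rewrite vg -!scalemxAl mxE mulf_neq0.
have sAxv : simple_null (mpeval A a) (mpeuler A a) x v^T
  := And4 Ax vA kerA vEx.
have pairing : (wt *m mpeuler (TP A) a *m z) 0 0
    = c * (v^T *m mpeuler A a *m x) 0 0.
  rewrite -(trmxK wt) -/w (TP_kernel_pairing Tw Tz) -/u -/v uc.
  by rewrite -scalemxAr mxE.
have sT : simple_null (mpeval (TP A) a) (mpeuler (TP A) a) z wt.
  split => // [z' Tz'|]; last by rewrite pairing mulf_neq0.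
  have [c' uc'] := kerA _ (TP_kernel_last Tz').
  exists (c' / c); apply/eqP; rewrite -subr_eq0; apply/eqP.
  apply: (@TP_kernel_eq0 _ _ _ A a) => //.
    by rewrite mulmxBr -scalemxAr Tz Tz' scaler0 subr0.
  rewrite /even_block submxcolB submxcolZ -!/(even_block _ _) uc' -/u uc.
  by rewrite scalerA divfK ?subrr.
split => //; rewrite (condnumE a_neq0 sT) (condnumE a_neq0 sAxv) pairing.
rewrite cabsM -/w trmxK uc norm2Z.
have Nx : 0 < norm2 x by rewrite norm2_gt0.
have Nv : 0 < norm2 v by rewrite norm2_gt0.
have bx : 0 < cabs ((v^T *m mpeuler A a *m x) 0 0) by rewrite cabs_gt0.
have Nc : 0 < cabs c by rewrite cabs_gt0.
have sA : 0 < mpnorm A (cabs a) by apply: mpnorm_gt0 a_neq0 sAxv.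
(* The inverse in [\bar R] is the real one away from 0, whence the positivity of the condition
   number of [A]. *)
rewrite inver ifF; last by rewrite gt_eqF // divr_gt0 ?mulr_gt0.
by rewrite -EFinM; congr (_%:E); field; rewrite !gt_eqF.
Qed.

Section Bounds.
Variables (A : matpoly R k n) (a : R[i]) (z : 'cV[R[i]]_(\sum_(c < k) n)).
Variable M : R.
Hypotheses (a_neq0 : a != 0) (Tz : mpeval (TP A) a *m z = 0).
Hypotheses (M_ge1 : 1 <= M) (A_le : forall i, specnorm (A i) <= M).
Local Notation al := (cabs a).
Local Notation U := (norm2 (even_block z 0)).
Local Notation X := (M * (Num.max 1 al ^+ m * U)).

Lemma le_max1_exp (d : R) i j : 0 <= d -> (i <= j)%N ->
  d ^+ i <= Num.max 1 d ^+ j.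
Proof.
move=> d_ge0 le_ij; apply: (@le_trans _ _ (Num.max 1 d ^+ i)).
  by rewrite lerXn2r ?nnegrE ?le_max ?ler01 ?lexx ?orbT.
by rewrite ler_weXn2l // le_max lexx.
Qed.

(** One bound for both directions of the recurrence. The minimum is |a| when |a| <= 1, from the
    exponent i + 1, and 1/|a| otherwise, from the division by [a]; it offsets the number of steps
    when |a| is far from 1. *)
Lemma TP_kernel_odd_le i : (i < m)%N ->
  norm2 (odd_block z i.+1) <= 2 * m%:R * Num.min al (1 / al) * X.
Proof.
move=> i_lt; have M_ge0 : 0 <= M := le_trans ler01 M_ge1.
have al_gt0 : 0 < al by rewrite cabs_gt0.
have al_ge0 := ltW al_gt0.
have pow_le j : (j <= m)%N -> al ^+ j * U <= Num.max 1 al ^+ m * U.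
  by move=> j_le; rewrite ler_wpM2r ?norm2_ge0 // le_max1_exp.
have [al_le1|al_ge1] : al <= 1 \/ 1 <= al by apply/orP/le_total.
  rewrite min_l; last by rewrite ler_pdivlMr // mulr_ile1.
  apply: (le_trans (TP_kernel_odd_le1 Tz A_le al_le1 (leqW i_lt))).
  rewrite exprS; have -> (p q r : R) : 2 * p * M * (al * q * r)
      = p * (2 * (al * (M * (q * r)))) by ring.
  have -> (p q : R) : 2 * p * al * q = p * (2 * (al * q)) by ring.
  apply: ler_pM; [exact: ler0n | nonneg | by rewrite ler_nat subSS leq_subr |].
  by rewrite !ler_wpM2l // pow_le // ltnW.
rewrite min_r; last by rewrite ler_pdivrMr // mulr_ege1.
rewrite mul1r mulrAC ler_pdivlMr // mulrC.
apply: (le_trans (TP_kernel_odd_ge1 Tz A_le al_ge1 i_lt)).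
rewrite -[leLHS]mulrA; apply: ler_pM; [nonneg | nonneg | |].
  by rewrite ler_wpM2l // ler_nat.
by rewrite ler_wpM2l // pow_le.
Qed.

Lemma sqr_norm2_kernel_le (q : R) : 2 * m%:R * Num.min al (1 / al) <= q ->
  norm2 z ^+ 2 <= (m.+1%:R + m%:R * q ^+ 2) * X ^+ 2.
Proof.
move=> q_ge; have M_ge0 : 0 <= M := le_trans ler01 M_ge1.
have g_ge0 : 0 <= Num.max 1 al by rewrite le_max ler01.
have X_ge0 : 0 <= X by nonneg.
rewrite sqr_norm2_parity mulrDl -mulrA -exprMn; apply: lerD.
  rewrite -[m.+1 in leRHS]card_ord mulr_natl -sumr_const.
  apply: ler_sum => i _; rewrite lerXn2r ?nnegrE ?norm2_ge0 //.
  rewrite (TP_kernel_even Tz) -1?ltnS // norm2Z cabsX.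
  apply: (@le_trans _ _ (1 * (Num.max 1 al ^+ m * U))).
    by rewrite mul1r ler_wpM2r ?norm2_ge0 // le_max1_exp ?cabs_ge0 // -ltnS.
  by rewrite ler_wpM2r //; nonneg.
rewrite -[m in m%:R]card_ord mulr_natl -sumr_const.
apply: ler_sum => i _.
have h : norm2 (odd_block z i.+1) <= q * X.
  apply: (le_trans (TP_kernel_odd_le (ltn_ord i))); exact: ler_wpM2r.
by rewrite lerXn2r ?nnegrE ?norm2_ge0 // (le_trans (norm2_ge0 _) h).
Qed.

Lemma sqr_norm2_kernel_ge :
  (\sum_(i < m.+1) al ^+ i.*2) * U ^+ 2 <= norm2 z ^+ 2.
Proof.
rewrite sqr_norm2_parity mulr_suml.
rewrite -[leLHS]addr0; apply: lerD; last first.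
  by apply: sumr_ge0 => i _; apply: sqr_ge0.
apply: ler_sum => i _.
have i_le : (i <= m)%N by rewrite -ltnS.
rewrite [even_block z i](TP_kernel_even Tz i_le) norm2Z cabsX.
by rewrite exprMn -exprM muln2.
Qed.
End Bounds.

(** The even powers come from the even blocks; the factor 1 + d, provided by the weight of the
    pencil, completes them to all powers up to k, as in the weight of [A]. *)
Lemma sum_even_exp (d : R) p :
  (1 + d) * \sum_(i < p.+1) d ^+ i.*2 = \sum_(s < p.+1.*2) d ^+ s.
Proof.
elim: p => [|p IHp].
  by rewrite big_ord1 !big_ord_recr big_ord0 /= !expr0 expr1 mulr1 add0r.
by rewrite big_ord_recr mulrDr IHp doubleS !big_ord_recr /= !exprS; ring.
Qed.

(** Only the constant term is kept when [s <= 1], only the leading one when [1 <= s]. *)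
Lemma mpnorm_ge_ends d0 (Q : matpoly R d0 n) (s : R) : 0 <= s ->
  Num.min (specnorm (Q ord_max)) (specnorm (Q ord0)) * Num.max 1 s ^+ d0
    <= mpnorm Q s.
Proof.
move=> s_ge0; rewrite /mpnorm.
have term_ge0 i : 0 <= s ^+ i * specnorm (Q (inord i)) by nonneg.
have [s_le1|s_ge1] : s <= 1 \/ 1 <= s by apply/orP/le_total.
  rewrite max_l // expr1n mulr1 (bigD1 ord0) //= expr0 mul1r.
  apply: (@le_trans _ _ (specnorm (Q ord0))).
    by rewrite ge_min [X in _ || X]lexx orbT.
  by rewrite lerDl; apply: sumr_ge0 => i _; nonneg.
rewrite max_r // (bigD1 ord_max) //= mulrC.
apply: (@le_trans _ _ (s ^+ d0 * specnorm (Q ord_max))).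
  by rewrite ler_wpM2l ?exprn_ge0 // ge_min [X in X || _]lexx.
by rewrite lerDl; apply: sumr_ge0 => i _; nonneg.
Qed.

Lemma mpnorm_le_max d0 (Q : matpoly R d0 n) (s mx : R) : 0 <= s ->
    (forall i, specnorm (Q i) <= mx) ->
  mpnorm Q s <= mx * \sum_(i < d0.+1) s ^+ i.
Proof.
move=> s_ge0 Q_le; rewrite mulr_sumr; apply: ler_sum => i _.
by rewrite mulrC ler_wpM2r ?exprn_ge0.
Qed.
End Ratio.

(** * Lower and upper bounds for the ratio *)

Section Main.
Variables (R : realType) (m n : nat).
Local Notation k := (m.*2.+1).
Implicit Types (A : matpoly R k n) (a : R[i]) (z : 'cV[R[i]]_(\sum_(c < k) n)).

Lemma specnorm_TP_block A (j : 'I_2) (a b : 'I_k) :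
  specnorm (TP_block A a.+1 b.+1 j) <= specnorm (TP A j).
Proof.
exact: (specnorm_block (fun a b : 'I_k => TP_block A a.+1 b.+1 j) a b).
Qed.

(** Both terms of the maximum come from blocks: an identity block, present since [0 < m], and the
    corner [A ord_max]. The nonzero [u] ensures that the identity has norm at least 1. *)
Lemma specnorm_TP1_ge A (u : 'cV[R[i]]_n) : (0 < m)%N -> u != 0 ->
  Num.max 1 (specnorm (A ord_max)) <= specnorm (TP A ord_max).
Proof.
move=> m_gt0 u_neq0; have lt1 : (1 < k)%N by lia.
have lt2 : (2 < k)%N by lia.
rewrite ge_max; apply/andP; split.
  apply: le_trans (specnorm_TP_block A ord_max (Ordinal lt1) (Ordinal lt2)).
  by apply: specnorm_ge u_neq0 _; rewrite mul1mx mul1r.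
apply: le_trans (specnorm_TP_block A ord_max ord0 ord0).
rewrite /TP_block /linear_coefs /= subn1 /=.
by rewrite (_ : inord _ = ord_max) //; apply: val_inj; rewrite /= inordK.
Qed.

Lemma specnorm_TP0_ge A (u : 'cV[R[i]]_n) : (0 < m)%N -> u != 0 ->
  Num.max 1 (specnorm (A ord0)) <= specnorm (TP A ord0).
Proof.
move=> m_gt0 u_neq0; have lt1 : (1 < k)%N by lia.
rewrite ge_max; apply/andP; split.
  apply: le_trans (specnorm_TP_block A ord0 ord0 (Ordinal lt1)).
  by apply: specnorm_ge u_neq0 _; rewrite mulNmx norm2N mul1mx mul1r.
apply: le_trans (specnorm_TP_block A ord0 ord_max ord_max).
rewrite /TP_block /linear_coefs eqxx /= odd_double /= subnn.
by rewrite (_ : inord _ = ord0) //; apply: val_inj; rewrite /= inordK.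
Qed.

Section Eigen.
Variables (A : matpoly R k n) (a : R[i]) (w z : 'cV[R[i]]_(\sum_(c < k) n)).
Hypotheses (m_gt0 : (0 < m)%N) (a_neq0 : a != 0).
Hypotheses (Tz : mpeval (TP A) a *m z = 0).
Hypotheses (Tw : mpeval (TP (fun i => (A i)^T)) a *m w = 0).
Hypotheses (u_neq0 : even_block z 0 != 0) (v_neq0 : even_block w 0 != 0).
Hypotheses (Ak_neq0 : A ord_max != 0) (A0_neq0 : A ord0 != 0).
Local Notation al := (cabs a).
Local Notation VU := (norm2 (even_block w 0) * norm2 (even_block z 0)).
Local Notation ratio :=
  (mpnorm (TP A) al * (norm2 w * norm2 z) / (mpnorm A al * VU)).

Let al_ge0 : 0 <= al := cabs_ge0 a.

Let VU_gt0 : 0 < VU. Proof. by rewrite mulr_gt0 ?norm2_gt0. Qed.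

Let min_gt0 : 0 < Num.min (specnorm (A ord_max)) (specnorm (A ord0)).
Proof. by rewrite lt_min; apply/andP; split; rewrite specnorm_gt0. Qed.

Let max1_gt0 : 0 < Num.max 1 al. Proof. by rewrite lt_max ltr01. Qed.

Let mpnormA_gt0 : 0 < mpnorm A al.
Proof.
apply: lt_le_trans (mpnorm_ge_ends _ al_ge0).
by rewrite mulr_gt0 // exprn_gt0.
Qed.

(** The weight of [A] is at most [mx * ((1 + al) * G)], that of the pencil at least [mn * (1 + al)],
    and the even blocks alone give [norm2 w * norm2 z >= G * VU]; everything but [mn / mx]
    cancels. *)
Lemma rho2_le_ratio : rho2 A <= ratio.
Proof.
rewrite /rho2; set mn := Num.min _ _; set mx := \big[Num.max/0]_(i < _) _.
have mx_le i : specnorm (A i) <= mx by apply: le_bigmax.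
have mx_gt0 : 0 < mx.
  by apply: lt_le_trans (mx_le ord_max); rewrite specnorm_gt0.
have max1_ge0 (s : R) : 0 <= Num.max 1 s by rewrite le_max ler01.
have mn_ge0 : 0 <= mn by rewrite le_min; apply/andP; split.
rewrite (ler_pdivlMr _ _ (mulr_gt0 mpnormA_gt0 VU_gt0)).
set G := \sum_(i < m.+1) al ^+ i.*2.
have G_ge0 : 0 <= G by apply: sumr_ge0 => i _; rewrite exprn_ge0.
have NN_ge : G * VU <= norm2 w * norm2 z.
  have le_w := sqr_norm2_kernel_ge Tw; have le_z := sqr_norm2_kernel_ge Tz.
  rewrite -(ler_pXn2r (_ : 0 < 2)%N) ?nnegrE; nonneg.
  rewrite !exprMn expr2 mulrACA; apply: ler_pM => //; nonneg.
have sgA_le : mpnorm A al <= mx * ((1 + al) * G).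
  by rewrite sum_even_exp; apply: mpnorm_le_max.
have sgT_ge : mn * (1 + al) <= mpnorm (TP A) al.
  rewrite mpnorm_pencil mulrDr mulr1; apply: lerD.
    apply: le_trans (specnorm_TP0_ge A m_gt0 u_neq0).
    by rewrite /mn ge_min [X in _ || X]lexx orbT.
  rewrite mulrC ler_wpM2l //.
  apply: le_trans (specnorm_TP1_ge A m_gt0 u_neq0).
  by rewrite /mn ge_min [X in X || _]lexx.
apply: (@le_trans _ _ (mn * (1 + al) * (G * VU))).
  have -> : mn * (1 + al) * (G * VU) = mn / mx * (mx * ((1 + al) * G) * VU).
    by field; rewrite gt_eqF.
  apply: ler_wpM2l; first by apply: divr_ge0 => //; apply: ltW.
  by rewrite ler_wpM2r // ltW.
apply: ler_pM => //; nonneg.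
Qed.

(** [M ^+ 3] has one factor from the coefficients of the pencil and one from each of [w] and [z]; 4
    is 2 from [specnorm_TP] times 2 from [1 + al <= 2 * g]. The powers of [g] add up to 1 + 2m = k
    and cancel against [mpnorm_ge_ends]. *)
Lemma ratio_le (q : R) : 2 * m%:R * Num.min al (1 / al) <= q ->
  ratio <= 4 * (m.+1%:R + m%:R * q ^+ 2) * rho1 A.
Proof.
move=> q_ge; rewrite /rho1; set B := \big[Num.max/1]_(i < _) _.
have mn_gt0 := min_gt0; set mn := Num.min _ _ in mn_gt0 *.
pose M : R := \big[Num.max/1]_(i < k.+1) specnorm (A i).
have M_le i : specnorm (A i) <= M by apply: le_bigmax.
have M_ge1 : 1 <= M by apply: bigmax_ge_id.
have M3_le : M ^+ 3 <= B.
  rewrite /M; elim/big_ind : _ => [|s t s_le t_le|i _].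
  - by rewrite expr1n bigmax_ge_id.
  - by rewrite maxEle; case: ifP.
  - by apply: (le_bigmax _ (fun i => specnorm (A i) ^+ 3)).
have M_ge0 := le_trans ler01 M_ge1.
have AT_le i : specnorm ((A i)^T) <= M by rewrite specnorm_tr.
set c := m.+1%:R + _; pose g := Num.max 1 al.
have g_ge1 : 1 <= g by rewrite le_max lexx.
have g_ge0 := le_trans ler01 g_ge1.
have c_ge0 : 0 <= c.
  by apply: addr_ge0 => //; apply: mulr_ge0 => //; apply: sqr_ge0.
have NN_le : norm2 w * norm2 z <= c * (M * g ^+ m) ^+ 2 * VU.
  have le_w := sqr_norm2_kernel_le a_neq0 Tw M_ge1 AT_le q_ge.
  have le_z := sqr_norm2_kernel_le a_neq0 Tz M_ge1 M_le q_ge.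
  rewrite -(ler_pXn2r (_ : 0 < 2)%N) ?nnegrE; nonneg.
  rewrite -/c -/g in le_w le_z.
  rewrite exprMn (le_trans (ler_pM (sqr_ge0 _) (sqr_ge0 _) le_w le_z)) //.
  by rewrite le_eqVlt; apply/orP; left; apply/eqP; ring.
have sgT_le : mpnorm (TP A) al <= 2 * M * (2 * g).
  rewrite mpnorm_pencil.
  have h1 := specnorm_TP M_ge1 M_le ord0.
  have h2 : al * specnorm (TP A ord_max) <= g * (2 * M).
    apply: ler_pM; [by [] | exact: specnorm_ge0 | |].
      by rewrite le_max lexx orbT.
    exact: specnorm_TP M_ge1 M_le ord_max.
  move: (specnorm _) (specnorm _) h1 h2 => s0 s1 h1 h2.
  have h3 : 1 * M <= g * M by rewrite ler_wpM2r.
  lra.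
have sgA_ge : mn * g ^+ k <= mpnorm A al := mpnorm_ge_ends _ al_ge0.
rewrite (ler_pdivrMr _ _ (mulr_gt0 mpnormA_gt0 VU_gt0)).
apply: (@le_trans _ _ (2 * M * (2 * g) * (c * (M * g ^+ m) ^+ 2 * VU))).
  apply: ler_pM => //; first by rewrite mpnorm_ge0.
  by nonneg.
have -> : 2 * M * (2 * g) * (c * (M * g ^+ m) ^+ 2 * VU)
    = 4 * c * (M ^+ 3 / mn) * (mn * g ^+ k * VU).
  have -> : g ^+ k = g * g ^+ m ^+ 2 by rewrite exprS -exprM muln2.
  by field; rewrite gt_eqF.
apply: ler_pM; nonneg; [exact: ltW|exact: ltW| |].
  by rewrite ler_wpM2l ?mulr_ge0 // ler_wpM2r // invr_ge0 ltW.
by rewrite ler_wpM2r // ltW.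
Qed.
End Eigen.
End Main.

Theorem theorem5p1 (R : realType) (k n : nat) (A : matpoly R k n)
    (delta : R[i]) (x : 'cV[R[i]]_n) (z : 'cV[R[i]]_(\sum_(a < k) n))
    (k_gt2 : (2 < k)%N) (k_odd : odd k)
    (A_regular : mpregular A)
    (Ak_neq0 : A ord_max != 0) (A0_neq0 : A ord0 != 0)
    (delta_simple : simple_eigenvalue A delta) (delta_neq0 : delta != 0)
    (x_eigen : right_eigenvector A delta x)
    (z_eigen : right_eigenvector (TP A) delta z) :
  ((rho2 A)%:E <= condnum (TP A) delta z / condnum A delta x
      <= (2 * k%:R ^+ 3 * rho1 A)%:E)%E
  /\ (cabs delta != 1 ->
      Num.min (cabs delta) (1 / cabs delta) <= 1 / (k%:R - 1) ->
      (condnum (TP A) delta z / condnum A delta x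
        <= (4 * (k%:R + 1) * rho1 A)%:E)%E).
Proof.
have [m km] : exists m, k = m.*2.+1.
  by exists k./2; rewrite -{1}(odd_double_half k) k_odd.
subst k; have m_gt0 : (0 < m)%N by lia.
have [w [Tw v_neq0 u_neq0 ->]] :=
  condnum_ratio A_regular delta_neq0 delta_simple x_eigen z_eigen.
have [z_neq0 Tz] := z_eigen.
have m_ge1 : 1 <= m%:R :> R by rewrite ler1n.
have kE : m.*2.+1%:R = 2 * m%:R + 1 :> R.
  by rewrite -addn1 natrD -muln2 natrM mulrC.
have rho1_ge0 : 0 <= rho1 A.
  apply: divr_ge0; first exact: le_trans ler01 (bigmax_ge_id _ _ _ _).
  by rewrite le_min; apply/andP; split; apply: specnorm_ge0.
have al_gt0 : 0 < cabs delta by rewrite cabs_gt0.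
have upper q := @ratio_le _ _ _ A delta w z delta_neq0 Tz Tw u_neq0 v_neq0
  Ak_neq0 A0_neq0 q.
split => [|_ min_le]; rewrite !lee_fin.
  apply/andP; split; first exact: rho2_le_ratio.
  (* The minimum is at most 1, so q = 2m is admissible, and 4 (m + 1 + 4 m^3) <= 2 (2m + 1)^3. *)
  apply: (le_trans (upper (2 * m%:R) _)).
    rewrite -[leRHS]mulr1 ler_wpM2l ?mulr_ge0 // ge_min.
    by rewrite ler_pdivrMr // mul1r le_total.
  rewrite ler_wpM2r // kE -[m.+1%:R]natr1.
  have : 1 <= m%:R ^+ 2 :> R by rewrite exprn_ege1.
  move: (m%:R) m_ge1 => p p_ge1 p2_ge1; lra.
(* As k - 1 = 2m, the hypothesis admits q = 1, and the constant is 4 (2m + 1) = 4k. *)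
apply: (le_trans (upper 1 _)).
  apply: (le_trans (ler_wpM2l _ min_le)); first by rewrite mulr_ge0.
  by rewrite kE addrK mul1r divff // gt_eqF // mulr_gt0 // (lt_le_trans ltr01).
by rewrite ler_wpM2r // kE expr1n -[m.+1%:R]natr1; lra.
Qed.
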